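(* Let $n\ge 2$. For $s,t\in\{2,3,\ldots,n\}$ and $i\in\{1,2,\ldots,n\}$, $$ \overline{\overline{\underline{A_{n,s,i,t}}}} = |\overline{A}|_{n,s+1,i,t} + |\overline{A}|_{n,s+1,i,t+1} + |\overline{A}|_{n,s,i+1,t} - |\overline{A}|_{n,s+1,i+1,t} - |\overline{A}|_{n,s,i,t+1} - |\overline{A}|_{n,s+1,i-1,t+1}, $$ where by convention $|\overline{A}|_{n,n+1,i,t} = |\overline{A}|_{n,s,i,n+1} = |\overline{A}|_{n,s,0,t} = |\overline{A}|_{n,s,n+1,t}=0$.
   Context: An $n\times n$ alternating sign matrix is a square matrix with entries in $\{1,-1,0\}$ such that in every row and every column the entries sum to $1$ and the non-zero entries alternate in sign. For $s,i,t\in\{1,\ldots,n\}$, $|\overline{A}|_{n,s,i,t}$ denotes the number of $n\times n$ alternating sign matrices having a $1$ in position $(s,1)$, a $1$ in position $(1,i)$ and a $1$ in position $(t,n)$ (row index first). Let $E_x$ denote the shift operator $E_x p(x)=p(x+1)$ and $\mathrm{id}$ the identity operator. For integers $k_1,\ldots,k_n$ define $$\alpha(n;k_1,\ldots,k_n)=\prod_{1\le p<q\le n}(\mathrm{id}-E_{k_p}+E_{k_p}E_{k_q})\prod_{1\le i<j\le n}\frac{k_j-k_i}{j-i},$$ a polynomial in $k_1,\ldots,k_n$ of degree at most $n-1$ in each variable (for strictly increasing $k_1<\dots<k_n$ it equals the number of monotone triangles with bottom row $(k_1,\ldots,k_n)$). The numbers $\overline{\overline{\underline{A_{n,s,i,t}}}}$,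 $s,i,t\in\{1,\ldots,n\}$, are defined as the unique coefficients in the polynomial expansion $$\alpha(n;k_1,2,3,\ldots,n-2,k_{n-1},k_n)=\sum_{s=1}^n\sum_{i=1}^n\sum_{t=1}^n \overline{\overline{\underline{A_{n,s,i,t}}}}\,(-1)^{s+1}\binom{k_1-2}{s-1}\binom{k_{n-1}-n+i}{i-1}\binom{k_n-n+t}{t-1},$$ where $\binom{x}{m}=x(x-1)\cdots(x-m+1)/m!$ as a polynomial in $x$. (For $i<t$ these numbers count $n\times n$ alternating sign matrices with respect to prescribed two top rows and bottom row; the identity is asserted for all $s,i,t$ in the stated ranges, including $i\ge t$.) *)

(* Defs.v *)
From HB Require Import structures.
From mathcomp Require Import all_boot all_order all_algebra.
Set Implicit Arguments. Unset Strict Implicit. Unset Printing Implicit Defensive.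
Import Order.TTheory GRing.Theory Num.Theory.
Local Open Scope ring_scope.

Definition is_ASM (n : nat) (A : 'M[int]_n) : bool :=
  [forall i, forall j, A i j \in [:: -1; 0; 1]] &&
  [forall i, \sum_(j < n) A i j == 1] &&
  [forall j, \sum_(i < n) A i j == 1] &&
  [forall i, forall j1 : 'I_n, forall j2 : 'I_n,
     [&& (j1 < j2)%N, A i j1 != 0, A i j2 != 0 &
         [forall j : 'I_n, ((j1 < j)%N && (j < j2)%N) ==> (A i j == 0)]]
     ==> (A i j2 == - A i j1)] &&
  [forall j, forall i1 : 'I_n, forall i2 : 'I_n,
     [&& (i1 < i2)%N, A i1 j != 0, A i2 j != 0 &
         [forall i : 'I_n, ((i1 < i)%N && (i < i2)%N) ==> (A i j == 0)]]
     ==> (A i2 j == - A i1 j)].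

(* Position (p, q), 1-based (row index first), of A holds a 1.  False when
   the position lies outside {1..n} x {1..n}. *)
Definition one_at (n : nat) (A : 'M[int]_n) (p q : nat) : bool :=
  [exists r : 'I_n, exists c : 'I_n,
     [&& r.+1 == p, c.+1 == q & A r c == 1]].

(* Finite encoding used only for counting: a matrix with entries in 'I_3
   is sent to the integer matrix with entries k - 1 in {-1,0,1}; this is
   an injection whose image contains every ASM. *)
Definition mx_of_code (n : nat) (f : 'M['I_3]_n) : 'M[int]_n :=
  \matrix_(i, j) ((f i j : nat)%:Z - 1).

(* |A-bar|_{n,s,i,t}: number of n x n ASMs with a 1 in positions (s,1),
   (1,i) and (t,n) (1-based).  Automatically 0 when s, i or t lies outside
   {1..n}, which gives the conventions of the statement. *)
Definition ASMcount (n s i t : nat) : nat :=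
  #|[set f : 'M['I_3]_n |
      [&& is_ASM (mx_of_code f), one_at (mx_of_code f) s 1,
          one_at (mx_of_code f) 1 i & one_at (mx_of_code f) t n]]|.

(* alpha is treated as a function on integer points k : 'I_n -> int
   (a polynomial with rational coefficients is determined by these
   values; shift operators act on such functions by E_p g (k) = g(k+e_p)). *)
Definition shiftE (n : nat) (p : 'I_n) (g : ('I_n -> int) -> rat)
  : ('I_n -> int) -> rat :=
  fun k => g (fun j => k j + (j == p)%:Z).

Definition opPQ (n : nat) (p q : 'I_n) (g : ('I_n -> int) -> rat)
  : ('I_n -> int) -> rat :=
  fun k => g k - shiftE p g k + shiftE p (shiftE q g) k.

Definition vdm (n : nat) (k : 'I_n -> int) : rat :=
  \prod_(i < n) \prod_(j < n | (i < j)%N)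
     ((k j - k i)%:~R / ((j : nat) - i)%:R).

Definition pairs_lt (n : nat) : seq ('I_n * 'I_n) :=
  [seq (p, q) | p <- enum (ordinal n), q <- [seq q <- enum (ordinal n) | (nat_of_ord p < nat_of_ord q)%N]].

(* alpha(n; k) = prod_{p<q} (id - E_{k_p} + E_{k_p}E_{k_q}) applied to vdm
   (the operators commute, so the order of the product is irrelevant). *)
Definition alpha (n : nat) : ('I_n -> int) -> rat :=
  foldr (fun pq g => opPQ pq.1 pq.2 g) (@vdm n) (pairs_lt n).

(* The argument vector (k_1, 2, 3, ..., n-2, k_{n-1}, k_n), 0-based
   positions: 0 -> x (= k_1), n-2 -> y (= k_{n-1}), n-1 -> z (= k_n),
   position j otherwise -> j+1.  (For n = 2 positions 0 and n-2 coincide;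
   we then use x.) *)
Definition kvec (n : nat) (x y z : int) : 'I_n -> int :=
  fun j => if (j : nat) == n.-1 then z
           else if (j : nat) == 0%N then x
           else if (j : nat) == n.-2 then y
           else (j.+1)%:Z.

Definition gbinom (x : rat) (m : nat) : rat :=
  (\prod_(j < m) (x - j%:R)) / (m`!)%:R.

(* c (indexed 1-based by s,i,t in {1..n}) are coefficients of the expansion
   alpha(n; k_1,2,...,n-2,k_{n-1},k_n)
     = sum_{s,i,t} c s i t (-1)^(s+1) binom(k_1-2, s-1)
                   binom(k_{n-1}-n+i, i-1) binom(k_n-n+t, t-1),
   as an identity of polynomials, i.e. at all integer points. *)
Definition is_expansion (n : nat) (c : nat -> nat -> nat -> rat) : Prop :=
  forall x y z : int,
    @alpha n (@kvec n x y z) =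
    \sum_(s < n) \sum_(i < n) \sum_(t < n)
      c s.+1 i.+1 t.+1 * (-1) ^+ (s.+2)
        * gbinom (x%:~R - 2) s
        * gbinom (y%:~R - n%:R + (i.+1)%:R) i
        * gbinom (z%:~R - n%:R + (t.+1)%:R) t.

(* Main.v *)
(* Products of shifts act on functions on Z^n, and alpha(n; .) is
   W = prod_(p < q) (1 - X_p + X_p X_q) applied to det (binom(k_i, j)).  Laplace
   expansion along the column j = 0 kills one variable, and W with X_p = 1 is the
   W of n - 1 variables times the shifts after p; the resulting alternating sum
   telescopes to Fischer's recursion: alpha(n; k) is the signed sum of
   alpha(n - 1; l) over the rows l interlacing k.  Hence differences
   X h = h(x) - h(x + 1) and Z h = h(z) - h(z - 1) in the outer variables peel off
   the outer diagonals of monotone triangles, and |A|_(n,s,i,t) is X^(s-2) Z^(t-2)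
   of H_i(x, z) = alpha(n - 1; x, {2..n-1} \ {i}, z) at (2, n - 1).  The expansion
   coefficients are X^(s-2) Z^(t-2) at (2, n - 2) of
   g_i(x, z) = (Z_y^(i-1) X Z alpha)(n; x, 2..n-2, y, z) at y = n - 2.
   Since W commutes with symmetric operators, prod_i (q + (1 - q) E_i) alpha =
   alpha for every q; together with the recursion this gives
     sum_i q^(i+1) g_i = sum_j q^j (q + (1 - q) E_x) (q + (1 - q) E_z) H_j,
   and the theorem is the comparison of coefficients of q^(i+1). *)
Require Import Defs.
From HB Require Import structures.
From mathcomp Require Import all_boot all_order all_algebra all_fingroup.
From mathcomp Require Import ssrcomplements mpoly zify ring lra.
Set Implicit Arguments. Unset Strict Implicit. Unset Printing Implicit Defensive.
Import Order.TTheory GRing.Theory Num.Theory.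
Local Open Scope ring_scope.

(** * Shift operators as polynomials *)

(** The differences are taken at points such as [(2, n - 2)], where the outer variables collide with
    the fixed entries and alpha is no longer a count. So every sum over rows is signed and
    polynomial in its bounds, and every step is an identity at all integer points. Repeated entries
    are then controlled by antisymmetry of the determinant. For [antialphaL] it gives a three-term
    relation at two equal neighbours, which makes the alternating sum telescope. For alpha(n - 1; .)
    it gives vanishing at three equal neighbours, which leaves only rows with one hole when the
    operators [q + (1 - q) E] act on a run of consecutive integers. On the matrix side, a row of
    bits records which columns have not yet used up their sum 1: the column conditions reduce to the
    last row of bits being zero, and the row conditions say that consecutive rows of bits
    interlace. *)

Section ShiftAction.
Variable n : nat.
Implicit Types (p q : {mpoly rat[n]}) (G : 'rV[int]_n -> rat) (v : 'rV[int]_n).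

Definition mrow (m : 'X_{1..n}) : 'rV[int]_n := \row_i (m i)%:Z.

Definition shift_act p G v : rat := \sum_(m <- msupp p) p@_m * G (v + mrow m).

Lemma mrow0 : mrow 0%MM = 0.
Proof. by apply/matrixP => i j; rewrite !mxE mnm0E. Qed.

Lemma mrowD m1 m2 : mrow (m1 + m2)%MM = mrow m1 + mrow m2.
Proof. by apply/rowP => i; rewrite !mxE mnmDE PoszD. Qed.

Lemma mrow1 i : mrow U_(i)%MM = delta_mx 0 i.
Proof. by apply/rowP => j; rewrite !mxE mnm1E eqxx eq_sym; case: eqP. Qed.

Lemma actwE k p G v : (msize p <= k)%N ->
  shift_act p G v = \sum_(m : 'X_{1..n < k}) p@_m * G (v + mrow m).
Proof.
move=> le_pk; pose I : subFinType _ := 'X_{1..n < k}.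
rewrite /shift_act (big_mksub I) ?msupp_uniq //=; first last.
  by move=> x /msize_mdeg_lt /leq_trans; apply.
by rewrite big_rmcond //= => m /memN_msupp_eq0 ->; rewrite mul0r.
Qed.

Lemma act_linear c p q G v : shift_act (c *: p + q) G v = c * shift_act p G v + shift_act q G v.
Proof.
pose k := (maxn (msize (c *: p + q)) (maxn (msize p) (msize q))).
rewrite !(@actwE k) ?leq_maxl // /k; try by rewrite !leq_max !leqnn ?orbT.
rewrite mulr_sumr -big_split /=; apply: eq_bigr => m _.
by rewrite mcoeffD mcoeffZ mulrDl mulrA.
Qed.

Lemma act0 G v : shift_act 0 G v = 0.
Proof. by rewrite /shift_act msupp0 big_nil. Qed.

Lemma actD p q G v : shift_act (p + q) G v = shift_act p G v + shift_act q G v.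
Proof. by have := act_linear 1 p q G v; rewrite scale1r mul1r. Qed.

Lemma actZ c p G v : shift_act (c *: p) G v = c * shift_act p G v.
Proof. by have := act_linear c p 0 G v; rewrite act0 !addr0. Qed.

Lemma actN p G v : shift_act (- p) G v = - shift_act p G v.
Proof. by rewrite -scaleN1r actZ mulN1r. Qed.

Lemma actX m G v : shift_act 'X_[m] G v = G (v + mrow m).
Proof. by rewrite /shift_act msuppX big_seq1 mcoeffX eqxx mul1r. Qed.

Lemma actXU i G v : shift_act 'X_i G v = G (v + delta_mx 0 i).
Proof. by rewrite actX mrow1. Qed.

Lemma act1 G v : shift_act 1 G v = G v.
Proof. by rewrite -mpolyX0 actX mrow0 addr0. Qed.

Lemma act_sum (I : Type) (r : seq I) (P : pred I) (f : I -> {mpoly rat[n]}) G v :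
  shift_act (\sum_(i <- r | P i) f i) G v = \sum_(i <- r | P i) shift_act (f i) G v.
Proof.
by elim/big_rec2: _ => [|i y1 y2 _ <-]; rewrite ?act0 ?actD.
Qed.

Lemma act_suml (I : Type) (r : seq I) (P : pred I) p (f : I -> rat)
    (G : I -> 'rV[int]_n -> rat) v :
  shift_act p (fun w => \sum_(i <- r | P i) f i * G i w) v =
  \sum_(i <- r | P i) f i * shift_act p (G i) v.
Proof.
rewrite /shift_act; under eq_bigr do rewrite mulr_sumr.
rewrite exchange_big /=; apply: eq_bigr => i _; rewrite mulr_sumr.
by apply: eq_bigr => m _; rewrite mulrCA.
Qed.

Lemma eq_act p G1 G2 v : G1 =1 G2 -> shift_act p G1 v = shift_act p G2 v.
Proof. by move=> e; apply: eq_bigr => m _; rewrite e. Qed.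

Lemma actM p q G v : shift_act (p * q) G v = shift_act p (shift_act q G) v.
Proof.
rewrite {1}[p]mpolyE mulr_suml act_sum; apply: eq_bigr => m _.
rewrite -scalerAl actZ; congr (_ * _).
rewrite {1}[q]mpolyE mulr_sumr act_sum; apply: eq_bigr => m' _.
by rewrite -scalerAr actZ -mpolyXD actX mrowD addrA.
Qed.

Lemma act_symm (s : 'S_n) p G v :
  shift_act (msym s p) G v = shift_act p (fun w => G (col_perm s^-1 w)) (col_perm s v).
Proof.
rewrite {1}[p]mpolyE raddf_sum act_sum; apply: eq_bigr => m _ /=.
rewrite msymZ actZ msymX actX; congr (_ * G _).
apply/rowP => i; rewrite !mxE permKV; congr (_ + Posz _).
by rewrite mnmE. 
Qed.

End ShiftAction.

(** * Symmetric operators acting on antisymmetric functions *)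

Section Antisymmetry.
Variable n : nat.
Implicit Types (p : {mpoly rat[n]}) (G : 'rV[int]_n -> rat) (v : 'rV[int]_n).

Lemma act_sym_anti (i j : 'I_n) p G v :
    (forall w, G (col_perm (tperm i j) w) = - G w) ->
    msym (tperm i j) p = p ->
  shift_act p G (col_perm (tperm i j) v) = - shift_act p G v.
Proof.
move=> antiG symp.
rewrite -{2}symp act_symm tpermV (eq_act p _ antiG).
by rewrite /shift_act -sumrN; apply: eq_bigr => m _; rewrite mulrN opprK.
Qed.

(** Swapping the two equal entries fixes [v] but changes the sign of the value. *)
Lemma act_sym_eq0 (i j : 'I_n) p G v :
    (forall w, G (col_perm (tperm i j) w) = - G w) ->
    msym (tperm i j) p = p -> v 0 i = v 0 j -> shift_act p G v = 0.
Proof.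
move=> antiG symp eqv; have := act_sym_anti v antiG symp.
have -> : col_perm (tperm i j) v = v.
  by apply/rowP => l; rewrite !mxE; case: tpermP => // ->.
lra.
Qed.

Definition wfac (i j : 'I_n) : {mpoly rat[n]} := 1 - 'X_i + 'X_i * 'X_j.

Definition Wpoly : {mpoly rat[n]} :=
  \prod_(ij : 'I_n * 'I_n | (ij.1 < ij.2)%N) wfac ij.1 ij.2.

Lemma msymXU (s : 'S_n) i : msym s 'X_i = 'X_(s i) :> {mpoly rat[n]}.
Proof.
by rewrite msymX; congr 'X_[_]; apply/mnmP => j;
   rewrite mnmE !mnm1E (canF_eq (permK s)).
Qed.

Lemma msym_wfac (s : 'S_n) i j : msym s (wfac i j) = wfac (s i) (s j).
Proof. by rewrite /wfac msymD msymB msymM msym1 !msymXU. Qed.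

(* The part of [Wpoly] that does not come from a pair inside an interval of
   [k] consecutive positions is invariant under permuting that interval. *)
Definition outer (a k : nat) (ij : 'I_n * 'I_n) : bool :=
  (ij.1 < ij.2)%N &&
  ~~ [&& (a <= ij.1)%N, (ij.1 < a + k)%N, (a <= ij.2)%N & (ij.2 < a + k)%N].

Definition Wouter a k : {mpoly rat[n]} :=
  \prod_(ij | outer a k ij) wfac ij.1 ij.2.

(** A position outside the interval lies before or after all of it, so the order of an outer pair
    survives the swap. *)
Lemma msym_Wouter a k (i j : 'I_n) :
    (a <= i < a + k)%N -> (a <= j < a + k)%N ->
  msym (tperm i j) (Wouter a k) = Wouter a k.
Proof.
move=> hi hj; rewrite /Wouter (rmorph_prod (msym _)) /=.
pose s2 (x : 'I_n * 'I_n) := (tperm i j x.1, tperm i j x.2).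
have s2K : cancel s2 s2 by case=> x y; rewrite /s2 /= !tpermK.
rewrite [RHS](reindex_inj (can_inj s2K)) /=; apply: eq_big => [[x y]|[x y] _].
  rewrite /outer /s2 /=; move: hi hj; case: (tpermP i j x) => [->|->|/eqP + /eqP +];
  case: (tpermP i j y) => [->|->|/eqP + /eqP +]; rewrite -?val_eqE /=; lia.
by rewrite /= msym_wfac.
Qed.

End Antisymmetry.

(** * Binomial determinants *)

Lemma gbinom0 x : gbinom x 0 = 1.
Proof. by rewrite /gbinom big_ord0 divr1. Qed.

Lemma gbinomS x m : gbinom x m.+1 * m.+1%:R = gbinom x m * (x - m%:R).
Proof.
rewrite /gbinom big_ord_recr /= factS natrM.
have h1 : m`!%:R != 0 :> rat by rewrite pnatr_eq0 -lt0n fact_gt0.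
have h2 : m.+1%:R != 0 :> rat by rewrite pnatr_eq0.
by move: h1 h2; move: (m.+1%:R : rat) (m`!%:R : rat) => b c h1 h2; field; apply/andP.
Qed.

Lemma gbinom_pascal x m : gbinom (x + 1) m.+1 = gbinom x m.+1 + gbinom x m.
Proof.
elim: m => [|m IHm].
  have := gbinomS (x + 1) 0; have := gbinomS x 0.
  by rewrite !gbinom0; lra.
have h2 : m.+2%:R != 0 :> rat by rewrite pnatr_eq0.
apply: (mulIf h2); rewrite mulrDl !gbinomS IHm.
have := gbinomS x m; rewrite -(natr1 m.+1) -!(natr1 m).
move: (gbinom x m) (gbinom x m.+1) (m%:R : rat) => u w c; nra.
Qed.

Definition binom (m : nat) (x : int) : rat := gbinom x%:~R m.

Lemma binom0 x : binom 0 x = 1. Proof. exact: gbinom0. Qed.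

Lemma binomS m x : binom m.+1 (x + 1) = binom m.+1 x + binom m x.
Proof. by rewrite /binom rmorphD /= gbinom_pascal. Qed.

Lemma binom_small m (j : nat) : (j < m)%N -> binom m j%:Z = 0.
Proof.
move=> lt_jm; rewrite /binom /gbinom (bigD1 (Ordinal lt_jm)) //=.
by rewrite pmulrn subrr !mul0r.
Qed.

Lemma binom_diag m : binom m m%:Z = 1.
Proof.
elim: m => [|m IHm]; first exact: binom0.
by rewrite -[m.+1]addn1 PoszD addn1 binomS binom_small // IHm add0r.
Qed.

(** [phi] is a parameter because the columns [binom j] and their discrete antiderivatives
    [binom j.+1] both occur. *)
Definition Ddet (phi : nat -> int -> rat) n (v : 'rV[int]_n) : rat :=
  \det (\matrix_(i, j < n) phi j (v 0 i)).

Lemma Ddet_anti phi n (i j : 'I_n) v : i != j ->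
  Ddet phi (col_perm (tperm i j) v) = - Ddet phi v.
Proof.
move=> neq_ij; rewrite /Ddet.
have -> : \matrix_(i0 < n, j0 < n) phi j0 (col_perm (tperm i j) v 0 i0)
        = row_perm (tperm i j) (\matrix_(i0 < n, j0 < n) phi j0 (v 0 i0)).
  by apply/matrixP => a b; rewrite !mxE.
by rewrite row_permE det_mulmx det_perm odd_tperm neq_ij mulN1r.
Qed.

(** Column 0 is constantly 1, so the term of [p] no longer involves the variable at [p]. *)
Lemma Ddet_expand n (v : 'rV[int]_n.+1) :
  Ddet binom v = \sum_(p < n.+1) (-1) ^+ p * Ddet (fun j => binom j.+1) (col' p v).
Proof.
rewrite /Ddet (expand_det_col _ ord0); apply: eq_bigr => p _.
rewrite mxE binom0 mul1r /cofactor addn0; congr (_ * \det _).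
by apply/matrixP => a b; rewrite !mxE.
Qed.

Section Factorwise.
Variables (n : nat) (a b : rat).

Definition tfac (i : 'I_n) : {mpoly rat[n]} := a *: 1 + b *: 'X_i.

Lemma act_tfac_prod (phi : 'I_n -> int -> rat) i v :
  shift_act (tfac i) (fun w => \prod_j phi j (w 0 j)) v =
  (a * phi i (v 0 i) + b * phi i (v 0 i + 1)) *
  \prod_(j | j != i) phi j (v 0 j).
Proof.
rewrite actD !actZ act1 actXU (bigD1 (P := predT) i) //=.
rewrite (bigD1 (P := predT) i (F := fun j => phi j ((v + delta_mx 0 i) 0 j))) //=.
rewrite !mxE !eqxx /= mulrDl !mulrA; congr (_ + _ * _).
by apply: eq_bigr => j /negPf nji; rewrite !mxE nji andbF addr0.
Qed.

Lemma act_tfacs_prod (phi : 'I_n -> int -> rat) (s : seq 'I_n) v : uniq s ->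
  shift_act (\prod_(i <- s) tfac i) (fun w => \prod_j phi j (w 0 j)) v =
  \prod_j (if j \in s then a * phi j (v 0 j) + b * phi j (v 0 j + 1)
           else phi j (v 0 j)).
Proof.
elim: s v => [|i s IHs] v; first by rewrite big_nil act1.
case/andP => nis us; rewrite big_cons actM.
pose psi j x := if j \in s then a * phi j x + b * phi j (x + 1) else phi j x.
rewrite (@eq_act _ _ _ (fun w => \prod_j psi j (w 0 j))); last first.
  by move=> w; rewrite IHs.
rewrite act_tfac_prod [RHS](bigD1 i) //= inE eqxx /=; congr (_ * _).
  by rewrite /psi (negPf nis).
by apply: eq_bigr => j /negPf nji; rewrite inE nji.
Qed.

(** Each Leibniz term has exactly one factor per variable, so the product of the operators acts
    entry by entry. *)
Lemma act_tfacs_Ddet phi v :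
  shift_act (\prod_(i < n) tfac i) (@Ddet phi n) v =
  Ddet (fun j x => a * phi j x + b * phi j (x + 1)) v.
Proof.
rewrite (@eq_act _ _ _ (fun w : 'rV_n => \sum_(s : 'S_n)
    (-1) ^+ s * \prod_i phi (s i) (w 0 i))); last first.
  move=> w; apply: eq_bigr => s _; congr (_ * _).
  by apply: eq_bigr => i _; rewrite mxE.
rewrite act_suml; apply: eq_bigr => s _; congr (_ * _).
rewrite (act_tfacs_prod (fun i => phi (s i))) ?index_enum_uniq //.
by apply: eq_bigr => i _; rewrite mem_index_enum mxE.
Qed.

End Factorwise.

Lemma Ddet_binS_diff n (v : 'rV[int]_n) :
  shift_act (\prod_(i < n) tfac (-1) 1 i) (@Ddet (fun j => binom j.+1) n) v =
  Ddet binom v.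
Proof.
rewrite act_tfacs_Ddet; congr (\det _); apply/matrixP => i j; rewrite !mxE binomS.
ring.
Qed.

(** [q + (1 - q) E] sends [binom j] to [binom j] plus [1 - q] times [binom (j - 1)]: a column
    operation by the unitriangular matrix [C]. *)
Lemma Ddet_bin_shift n q (v : 'rV[int]_n) :
  shift_act (\prod_(i < n) tfac q (1 - q) i) (@Ddet binom n) v = Ddet binom v.
Proof.
rewrite act_tfacs_Ddet /Ddet.
pose C : 'M[rat]_n := \matrix_(l, j)
  ((l == j)%:R + (1 - q) * (l.+1 == j :> nat)%:R).
have -> : (\matrix_(i, j) (q * binom j (v 0 i) + (1 - q) * binom j (v 0 i + 1)))
     = (\matrix_(i, j) binom j (v 0 i)) *m C.
  apply/matrixP => i j; rewrite !mxE.
  under eq_bigr do rewrite !mxE mulrDr.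
  rewrite big_split /= (bigD1 j) //= eqxx mulr1 big1 ?addr0; last first.
    by move=> l /negPf ->; rewrite mulr0.
  case: j => [[|j] ltj] /=.
    by rewrite !binom0 big1 => [|l _]; [ring | by rewrite !mulr0].
  rewrite (bigD1 (Ordinal (ltnW ltj))) //= eqxx big1 => [|l].
    by rewrite binomS /=; ring.
  by rewrite -val_eqE /= eqSS => /negPf ->; rewrite !mulr0.
rewrite det_mulmx -(det_tr C) (det_trig (A := C^T)).
  rewrite big1 ?mulr1 // => i _; rewrite !mxE eqxx.
  by rewrite gtn_eqF ?mulr0 ?addr0.
apply/is_trig_mxP => i j ltij; rewrite !mxE -val_eqE /=.
by rewrite !gtn_eqF ?mulr0 ?addr0 // ltnW.
Qed.

Lemma Ddet_vdm n (v : 'rV[int]_n) : vdm (v 0) = Ddet binom v.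
Proof.
have [c cE] : exists c, forall w : 'rV[int]_n,
    Ddet binom w = c * \prod_(i < n) \prod_(j < n | (i < j)%N) (w 0 j - w 0 i)%:~R.
  pose P (j : nat) : {poly rat} :=
    (j`!%:R)^-1 *: \prod_(l < j) ('X - (l%:R)%:P).
  have sP j : (size (P j) <= j.+1)%N.
    rewrite (leq_trans (size_scale_leq _ _)) // -(big_enum _ _ _ (fun l : 'I_j => 'X - (l%:R)%:P)) /=.
    by rewrite size_prod_XsubC size_enum_ord.
  have PE j x : (P j).[x%:~R] = binom j x.
    rewrite /P hornerZ horner_prod /binom /gbinom mulrC; congr (_ / _).
    by apply: eq_bigr => l _; rewrite !hornerE.
  exists (\det (\matrix_(l < n, j < n) (P j)`_l)) => w.
  rewrite /Ddet.
  have -> : \matrix_(i < n, j < n) binom j (w 0 i) =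
      (Vandermonde n (map_mx intr w))^T *m \matrix_(l < n, j < n) (P j)`_l.
    apply/matrixP => i j; rewrite !mxE -PE (horner_coef_wide _ (leq_trans (sP j) (ltn_ord j))).
    by apply: eq_bigr => l _; rewrite !mxE mulrC.
  rewrite det_mulmx det_tr det_Vandermonde mulrC; congr (_ * _).
  by apply: eq_bigr => i _; apply: eq_bigr => j _; rewrite !mxE rmorphB.
(* Both sides are multiples of the Vandermonde product. At 0, 1, ..., n - 1 the binomial matrix is
   unitriangular, which fixes the constant. *)
pose w0 : 'rV[int]_n := \row_i i%:Z.
have w0E : Ddet binom w0 = 1.
  rewrite /Ddet det_trig.
    by rewrite big1 // => i _; rewrite !mxE binom_diag.
  by apply/is_trig_mxP => i j ltij; rewrite !mxE; exact: binom_small.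
have := cE w0; rewrite w0E.
set d := \prod_(i < n) _ => cd1.
have d0 : d != 0 by apply: contra_eq_neq cd1 => ->; rewrite mulr0 oner_neq0.
rewrite cE (_ : c = d^-1); last by rewrite -[RHS]mul1r cd1 mulfK.
rewrite mulrC /vdm /d -prodfV -big_split /=; apply: eq_bigr => i _.
rewrite -prodfV -big_split /=; apply: eq_bigr => j ltij.
by rewrite !mxE subzn ?(ltnW ltij) // -pmulrn.
Qed.

(** * The polynomial alpha on lists *)

Lemma WpolyE n :
  Wpoly n = \prod_(i < n) \prod_(j < n | (i < j)%N) wfac i j.
Proof. by rewrite pair_big_dep. Qed.

Lemma alpha_act n (k : 'I_n -> int) :
  alpha k = shift_act (Wpoly n) (@Ddet binom n) (\row_i k i).
Proof.
have -> : Wpoly n = \prod_(pq <- pairs_lt n) wfac pq.1 pq.2.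
  rewrite WpolyE /pairs_lt big_allpairs_dep /= big_enum /=.
  by apply: eq_bigr => i _; rewrite big_filter big_enum_cond.
rewrite /alpha; elim: (pairs_lt n) k => [|[p q] s IHs] k /=.
  rewrite big_nil act1 -Ddet_vdm; apply: eq_bigr => i _; apply: eq_bigr => j _.
  by rewrite !mxE.
have E i (f : 'I_n -> int) : \row_j (f j + (j == i)%:Z) = \row_j f j + delta_mx 0 i.
  by apply/rowP => j; rewrite !mxE; case: eqP.
rewrite /opPQ /shiftE /= !IHs big_cons actM /= actD actD actN act1 actM !actXU.
by rewrite !E.
Qed.

(** * Setting one shift to 1 *)

Section RemoveVariable.
Variables (n : nat) (p : 'I_n.+1).

Definition drop_var : {mpoly rat[n.+1]} -> {mpoly rat[n]} :=
  mmap (@mpolyC n rat) (fun i => if unlift p i is Some j then 'X_j else 1).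

Lemma drop_varXU i : drop_var 'X_i = if unlift p i is Some j then 'X_j else 1.
Proof. by rewrite /drop_var mmapX mmap1U. Qed.

Lemma drop_var_wfac i j : drop_var (wfac i j) =
  1 - drop_var 'X_i + drop_var 'X_i * drop_var 'X_j.
Proof.
rewrite /drop_var /wfac (rmorphD (mmap _ _)) (rmorphB (mmap _ _)).
by rewrite (rmorphM (mmap _ _)) (rmorph1 (mmap _ _)).
Qed.

Lemma act_drop_var P G v :
  shift_act P (fun w => G (col' p w)) v = shift_act (drop_var P) G (col' p v).
Proof.
rewrite {2}[P]mpolyE /drop_var (raddf_sum (mmap _ _)) act_sum /=.
apply: eq_bigr => m _; rewrite mmapZ /= mul_mpolyC actZ; congr (_ * _).
rewrite mmapX /mmap1 (bigD1_ord p) //= unlift_none expr1n mul1r.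
under eq_bigr do rewrite liftK.
pose m' := [multinom m (lift p i) | i < n].
rewrite (eq_bigr (fun i => 'X_i ^+ m' i)) => [|i _]; last by rewrite mnmE.
rewrite -mpolyXE_id actX; congr (G _).
by apply/rowP => i; rewrite !mxE mnmE.
Qed.

Lemma drop_var_prod (I : Type) (r : seq I) (P : pred I) F :
  drop_var (\prod_(i <- r | P i) F i) = \prod_(i <- r | P i) drop_var (F i).
Proof. exact: (rmorph_prod (mmap _ _)). Qed.

(** At X_p = 1 the factor of a pair (p, j) becomes X_j, and that of a pair (i, p) becomes 1. *)
Lemma drop_var_Wpoly :
  drop_var (Wpoly n.+1) = (\prod_(j < n | (p <= j)%N) 'X_j) * Wpoly n.
Proof.
rewrite WpolyE drop_var_prod (bigD1_ord p) //=; congr (_ * _).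
  rewrite drop_var_prod big_mkcond (bigD1_ord p) //= ltnn mul1r.
  rewrite [RHS]big_mkcond; apply: eq_bigr => j _.
  rewrite (_ : (p < lift p j)%N = (p <= j)%N).
    by case: ifP => // _; rewrite drop_var_wfac !drop_varXU unlift_none liftK subrr add0r mul1r.
  by rewrite /= /bump; lia.
rewrite WpolyE; apply: eq_bigr => i _.
rewrite drop_var_prod big_mkcond (bigD1_ord p) //=.
have -> : drop_var (wfac (lift p i) p) = 1.
  by rewrite drop_var_wfac !drop_varXU unlift_none liftK mulr1 subrK.
rewrite if_same mul1r [RHS]big_mkcond; apply: eq_bigr => j _.
rewrite drop_var_wfac !drop_varXU !liftK (_ : (_ < _)%N = (i < j)%N) //.
by rewrite /= /bump; lia.
Qed.

End RemoveVariable.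

Lemma act_prodXM n (P : pred 'I_n) Q G v :
  shift_act ((\prod_(j | P j) 'X_j) * Q) G v =
  shift_act Q G (v + \sum_(j | P j) delta_mx 0 j).
Proof.
elim/big_rec2: _ v => [|j m x _ IH] v; first by rewrite mul1r addr0.
by rewrite -mulrA actM actXU IH addrA.
Qed.

Section Lists.
Variable n : nat.

Definition rowl (s : seq int) : 'rV[int]_n := \row_i s`_i.

Definition alphaL (s : seq int) : rat := shift_act (Wpoly n) (@Ddet binom n) (rowl s).
(* [alphaL n] is [antialphaL n] differenced once in every variable. *)
Definition antialphaL (s : seq int) : rat :=
  shift_act (Wpoly n) (@Ddet (fun j => binom j.+1) n) (rowl s).

End Lists.

(* Setting one shift of [Wpoly n.+1] to 1 gives [Wpoly n] times the shifts in
   the later variables, hence the [+ 1]. *)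
Lemma alphaL_sum n (s : seq int) :
  alphaL n.+1 s = \sum_(p < n.+1) (-1) ^+ p *
    antialphaL n (mkseq (fun j => if (j < p)%N then s`_j else s`_j.+1 + 1) n).
Proof.
rewrite /alphaL (eq_act _ _ (@Ddet_expand n)) act_suml; apply: eq_bigr => p _.
rewrite act_drop_var drop_var_Wpoly act_prodXM /antialphaL; congr (_ * shift_act _ _ _).
apply/rowP => i; rewrite !mxE nth_mkseq // summxE.
case: ltnP => hip.
  rewrite big1 ?addr0 => [|j hj]; first by rewrite /= /bump leqNgt hip.
  rewrite !mxE /= (_ : i == j = false) //.
  by apply: contraTF hip => /eqP ->; rewrite -leqNgt.
rewrite (bigD1 i) //= big1 ?addr0 => [|j /andP [_ hj]].
  by rewrite !mxE !eqxx /bump hip.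
by rewrite !mxE eq_sym (negPf hj) andbF.
Qed.

(* [a id + b E], applied in every variable of [h]. *)
Fixpoint eachvar (a b : rat) (h : seq int -> rat) (s : seq int) : rat :=
  if s is x :: r then
    a * eachvar a b (h \o cons x) r + b * eachvar a b (h \o cons (x + 1)) r
  else h [::].

Lemma eq_eachvar a b h h' s :
  (forall t, size t = size s -> h t = h' t) -> eachvar a b h s = eachvar a b h' s.
Proof.
elim: s h h' => [|x r IH] h h' e /=; first exact: e.
by congr (_ * _ + _ * _); apply: IH => t st /=; apply: e; rewrite /= st.
Qed.

Lemma act_tfacs_eachvar n a b G (s : seq int) : size s = n ->
  shift_act (\prod_(i < n) tfac a b i) G (rowl n s) = eachvar a b (G \o rowl n) s.
Proof.
move=> sz.
(* Induction on the suffix: the operators at positions before [size s1] are left out, so [s1] stays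
   fixed. *)
suff H s2 s1 : size (s1 ++ s2) = n ->
    shift_act (\prod_(i < n | (size s1 <= i)%N) tfac a b i) G (rowl n (s1 ++ s2)) =
    eachvar a b (fun t => G (rowl n (s1 ++ t))) s2.
  by rewrite -(H s [::]).
elim: s2 s1 => [|x r IH] s1 szs.
  rewrite big1 ?act1 // => i; rewrite -[X in (X <= i)%N]addn0.
  by move: szs; rewrite size_cat /= => ->; rewrite leqNgt ltn_ord.
have lt1 : (size s1 < n)%N by rewrite -szs size_cat /=; lia.
rewrite (bigD1 (Ordinal lt1)) //= actM.
rewrite (eq_bigl (fun i : 'I_n => (size (rcons s1 x) <= i)%N)); last first.
  by move=> i; rewrite size_rcons -val_eqE /=; lia.
rewrite /tfac actD !actZ act1 actXU.
rewrite (_ : rowl n _ + _ = rowl n (s1 ++ (x + 1) :: r)); last first.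
  apply/rowP => i; rewrite !mxE !nth_cat eqxx -(val_eqE i) /=; case: ltnP => h1.
    by rewrite ltn_eqF // addr0.
  case: eqP => [->|/eqP ne]; first by rewrite subnn.
  have -> : (i - size s1 = (i - size s1).-1.+1)%N by lia.
  by rewrite addr0.
by congr (_ * _ + _ * _); [move: (IH (rcons s1 x))|move: (IH (rcons s1 (x + 1)))];
   rewrite !size_rcons !cat_rcons => -> //; try (by rewrite -szs !size_cat);
   apply: eq_eachvar => t _ /=; rewrite cat_rcons.
Qed.

Lemma Wpoly_outer2 n (i j : 'I_n) : j = i.+1 :> nat ->
  Wpoly n = wfac i j * Wouter n i 2.
Proof.
move=> ji; rewrite /Wpoly (bigD1 (i, j)) /= ?ji //; congr (_ * _).
apply: eq_bigl => [[x y]]; rewrite /outer /= xpair_eqE -!val_eqE /= ji.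
by apply/idP/idP; lia.
Qed.

Lemma Wpoly_outer3 n (i j k : 'I_n) : j = i.+1 :> nat -> k = i.+2 :> nat ->
  Wpoly n = wfac i j * wfac i k * wfac j k * Wouter n i 3.
Proof.
move=> ji ki; rewrite /Wpoly (bigD1 (i, j)) /= ?ji //.
rewrite (bigD1 (i, k)) /=; last by rewrite ki xpair_eqE -!val_eqE /= ki ji; lia.
rewrite (bigD1 (j, k)) /=; last by rewrite ki !xpair_eqE -!val_eqE /= ki ji; lia.
rewrite !mulrA; congr (_ * _).
apply: eq_bigl => [[x y]]; rewrite /outer /= !xpair_eqE -!val_eqE /= ji ki.
by apply/idP/idP; lia.
Qed.

Lemma rowl_cat_mid n s1 x s2 (i : 'I_n) : i = size s1 :> nat ->
  (rowl n (s1 ++ x :: s2)) 0 i = x.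
Proof. by move=> e; rewrite mxE e nth_cat ltnn subnn. Qed.

Lemma rowl_addU n s1 x s2 (i : 'I_n) : i = size s1 :> nat ->
  rowl n (s1 ++ x :: s2) + delta_mx 0 i = rowl n (s1 ++ (x + 1) :: s2).
Proof.
move=> e; apply/rowP => j; rewrite !mxE !nth_cat eqxx -(val_eqE j) /= e.
case: ltnP => h1; first by rewrite ltn_eqF ?addr0.
case: eqP => [->|/eqP ne]; first by rewrite subnn.
have -> : (j - size s1 = (j - size s1).-1.+1)%N by lia.
by rewrite addr0.
Qed.

(** The three terms are [wfac j i] applied at the adjacent positions [i], [j]. It completes the
    factor [wfac i j] of [Wpoly] to a product symmetric in the two shifts, and this kills the
    antisymmetric determinant at equal entries. *)
Lemma antialphaL_local n s1 b s2 : size (s1 ++ b :: b :: s2) = n ->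
  antialphaL n (s1 ++ b :: b :: s2) - antialphaL n (s1 ++ b :: (b + 1) :: s2)
  + antialphaL n (s1 ++ (b + 1) :: (b + 1) :: s2) = 0.
Proof.
move=> sz.
have lti : (size s1 < n)%N by rewrite -sz size_cat /=; lia.
have ltj : (size (rcons s1 b) < n)%N by rewrite -sz size_rcons size_cat /=; lia.
pose i := Ordinal lti; pose j := Ordinal ltj.
have ji : j = i.+1 :> nat by rewrite /= size_rcons.
have nij : i != j by rewrite -val_eqE /= size_rcons; lia.
set G := @Ddet (fun j => binom j.+1) n.
have : shift_act (wfac j i * Wpoly n) G (rowl n (s1 ++ b :: b :: s2)) = 0.
  apply: (@act_sym_eq0 _ i j).
  - by move=> w; exact: Ddet_anti.
  - rewrite (Wpoly_outer2 ji) !msymM !msym_wfac tpermL tpermR msym_Wouter /=.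
    + by rewrite mulrCA.
    + by rewrite leqnn -[X in (X < _)%N]addn0 ltn_add2l.
    + by rewrite size_rcons; lia.
  - by rewrite rowl_cat_mid // -cat_rcons rowl_cat_mid.
rewrite actM actD actD actN act1 actM !actXU -cat_rcons rowl_addU // !cat_rcons.
by rewrite rowl_addU.
Qed.

(** Two equal neighbours would not suffice: alpha(2; b, b) = 1. With three, the non-symmetric part
    of [Wpoly] splits into pieces, each symmetric in some pair of equal entries. *)
Lemma alphaL_triple n s1 b s2 : size (s1 ++ b :: b :: b :: s2) = n ->
  alphaL n (s1 ++ b :: b :: b :: s2) = 0.
Proof.
move=> sz.
have lti : (size s1 < n)%N by rewrite -sz size_cat /=; lia.
have ltj : ((size s1).+1 < n)%N by rewrite -sz size_cat /=; lia.
have ltk : ((size s1).+2 < n)%N by rewrite -sz size_cat /=; lia.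
pose i := Ordinal lti; pose j := Ordinal ltj; pose k := Ordinal ltk.
have nij : i != j by rewrite -val_eqE /=; lia.
have nik : i != k by rewrite -val_eqE /=; lia.
have njk : j != k by rewrite -val_eqE /=; lia.
set v := rowl n (s1 ++ b :: b :: b :: s2).
have vi : v 0 i = b by rewrite rowl_cat_mid.
have vj : v 0 j = b by rewrite /v -cat_rcons rowl_cat_mid ?size_rcons.
have vk : v 0 k = b by rewrite /v -cat_rcons -cat_rcons rowl_cat_mid ?size_rcons.
have Z x y Q : x != y -> v 0 x = v 0 y ->
    (size s1 <= x < size s1 + 3)%N -> (size s1 <= y < size s1 + 3)%N ->
    msym (tperm x y) Q = Q -> shift_act (Q * Wouter n (size s1) 3) (@Ddet binom n) v = 0.
  move=> nxy vxy hx hy sQ; apply: (@act_sym_eq0 _ x y) => //.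
    by move=> w; exact: Ddet_anti.
  by rewrite msymM sQ msym_Wouter.
rewrite /alphaL (Wpoly_outer3 (i := i) (j := j) (k := k)) // -/v /=.
pose a : {mpoly rat[n]} := 'X_i; pose c : {mpoly rat[n]} := 'X_j.
pose d : {mpoly rat[n]} := 'X_k.
(* One summand for each transposition fixing it: [j <-> k], [i <-> j], [i <-> k]. *)
have -> : wfac i j * wfac i k * wfac j k =
    (1 - a - a + a * a - (a * c * d + a * c * d + a * c * d)
       + (a * a * c * d + a * a * c * d + a * a * c * d)
       + a * a * c * c * d * d - a * a * c - a * a * d + c * d)
    + (a * c + a * c + a * c + a * a * c * c
       - (a * a * c * c * d + a * a * c * c * d) + a * c * d * d
       - a * a * c - a * c * c)
    + (- c + a * d + a * c * c * d - a * a * c * d * d).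
  by rewrite /wfac -/a -/c -/d; ring.
have rng (x : nat) : (x < 3)%N -> (size s1 <= size s1 + x < size s1 + 3)%N.
  by move=> hx; rewrite leq_addr ltn_add2l.
have hi := rng 0%N isT; have hj := rng 1%N isT; have hk := rng 2%N isT.
rewrite addn0 in hi; rewrite addn1 in hj; rewrite addn2 in hk.
rewrite 2!mulrDl 2!actD.
have E := (msymB, msymD, msymN, msymM, msym1, msymXU).
rewrite (Z j k) ?vj ?vk //; last first.
  by rewrite /a /c /d !E tpermL tpermR tpermD 1?eq_sym // -/a -/c -/d; ring.
rewrite (Z i j) ?vi ?vj //; last first.
  by rewrite /a /c /d !E tpermL tpermR tpermD // -/a -/c -/d; ring.
rewrite (Z i k) ?vi ?vk ?addr0 //.
by rewrite /a /c /d !E tpermL tpermR tpermD // 1?eq_sym // -/a -/c -/d; ring.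
Qed.

Lemma alphaL_antialphaL n s : size s = n -> alphaL n s = eachvar (-1) 1 (antialphaL n) s.
Proof.
move=> sz; rewrite -[RHS](act_tfacs_eachvar (-1) 1 _ sz) -actM mulrC actM.
by apply: eq_act => w; rewrite Ddet_binS_diff.
Qed.

Lemma alphaL_eachvar n q s : size s = n -> eachvar q (1 - q) (alphaL n) s = alphaL n s.
Proof.
move=> sz; rewrite -[LHS](act_tfacs_eachvar q (1 - q) _ sz) -actM mulrC actM.
by apply: eq_act => w; rewrite Ddet_bin_shift.
Qed.

(** * Differences and Newton expansions *)

Definition dif (g : int -> rat) (x : int) : rat := g (x + 1) - g x.
Definition Xop (g : int -> rat) (x : int) : rat := g x - g (x + 1).
Definition Zop (g : int -> rat) (x : int) : rat := g x - g (x - 1).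

Section LinearOperator.
Variable op : (int -> rat) -> int -> rat.
Hypothesis eq_op : forall g h, g =1 h -> op g =1 op h.
Hypothesis op_lin : forall c g h x,
  op (fun y => c * g y + h y) x = c * op g x + op h x.

Lemma eq_iterop k g h : g =1 h -> iter k op g =1 iter k op h.
Proof. by elim: k => //= k IH e; apply: eq_op; apply: IH. Qed.

Lemma iterop_lin k c g h x :
  iter k op (fun y => c * g y + h y) x = c * iter k op g x + iter k op h x.
Proof.
elim: k x => //= k IH x; rewrite -op_lin.
by apply: eq_op => y; rewrite IH.
Qed.

Lemma iterop0 k x : iter k op (fun=> 0) x = 0.
Proof.
have := iterop_lin k (-1) (fun=> 0) (fun=> 0) x.
rewrite (eq_iterop _ (h := fun=> 0)) => [|y]; first by lra.
by rewrite mulr0 addr0.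
Qed.

Lemma iterop_scale k c g x : iter k op (fun y => c * g y) x = c * iter k op g x.
Proof.
have := iterop_lin k c g (fun=> 0) x; rewrite iterop0 addr0 => <-.
by apply: eq_iterop => y; rewrite addr0.
Qed.

Lemma iterop_add k g h x :
  iter k op (fun y => g y + h y) x = iter k op g x + iter k op h x.
Proof.
have := iterop_lin k 1 g h x; rewrite mul1r => <-.
by apply: eq_iterop => y; rewrite mul1r.
Qed.

Lemma iterop_sum (I : Type) (r : seq I) (P : pred I) (G : I -> int -> rat) k x :
  iter k op (fun y => \sum_(i <- r | P i) G i y) x =
  \sum_(i <- r | P i) iter k op (G i) x.
Proof.
elim: r => [|i r IH].
  rewrite big_nil -[RHS](iterop0 k x).
  by apply: eq_iterop => y; rewrite big_nil.
rewrite big_cons -IH; case Pi: (P i); last first.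
  by apply: eq_iterop => y; rewrite big_cons Pi.
by rewrite -iterop_add; apply: eq_iterop => y; rewrite big_cons Pi.
Qed.

End LinearOperator.

Lemma eq_dif g h : g =1 h -> dif g =1 dif h.
Proof. by move=> e x; rewrite /dif !e. Qed.
Lemma eq_Xop g h : g =1 h -> Xop g =1 Xop h.
Proof. by move=> e x; rewrite /Xop !e. Qed.
Lemma eq_Zop g h : g =1 h -> Zop g =1 Zop h.
Proof. by move=> e x; rewrite /Zop !e. Qed.
Lemma dif_lin c g h x : dif (fun y => c * g y + h y) x = c * dif g x + dif h x.
Proof. by rewrite /dif; ring. Qed.
Lemma Xop_lin c g h x : Xop (fun y => c * g y + h y) x = c * Xop g x + Xop h x.
Proof. by rewrite /Xop; ring. Qed.
Lemma Zop_lin c g h x : Zop (fun y => c * g y + h y) x = c * Zop g x + Zop h x.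
Proof. by rewrite /Zop; ring. Qed.

Lemma iter_difE k g h : g =1 h -> iter k dif g =1 iter k dif h.
Proof. exact: (eq_iterop eq_dif). Qed.

Lemma iter_XopE k g h : g =1 h -> iter k Xop g =1 iter k Xop h.
Proof. exact: (eq_iterop eq_Xop). Qed.

Lemma iter_ZopE k g h : g =1 h -> iter k Zop g =1 iter k Zop h.
Proof. exact: (eq_iterop eq_Zop). Qed.

Lemma iter_Xop_dif k g x : iter k Xop g x = (-1) ^+ k * iter k dif g x.
Proof.
elim: k g x => [|k IH] g x; first by rewrite mul1r.
rewrite !iterSr IH exprSr -mulrA -(iterop_scale eq_dif dif_lin k (-1)).
by congr (_ * _); apply: iter_difE => y; rewrite /Xop /dif; ring.
Qed.

Lemma iter_op_shift (op : (int -> rat) -> int -> rat) k g (m : int) x :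
    (forall h y, op (fun z => h (z + m)) y = op h (y + m)) ->
    (forall g h, g =1 h -> op g =1 op h) ->
  iter k op (fun z => g (z + m)) x = iter k op g (x + m).
Proof.
move=> sh e; elim: k g x => [|k IH] g x //=.
by rewrite -sh; apply: e => y; rewrite IH.
Qed.

Lemma iter_dif_shift k g m x :
  iter k dif (fun z => g (z + m)) x = iter k dif g (x + m).
Proof.
apply: iter_op_shift; last exact: eq_dif.
by move=> h y; rewrite /dif addrAC.
Qed.

Lemma iter_Xop_shift k g m x :
  iter k Xop (fun z => g (z + m)) x = iter k Xop g (x + m).
Proof.
apply: iter_op_shift; last exact: eq_Xop.
by move=> h y; rewrite /Xop addrAC.
Qed.

Lemma iter_Zop_shift k g m x :
  iter k Zop (fun z => g (z + m)) x = iter k Zop g (x + m).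
Proof.
apply: iter_op_shift; last exact: eq_Zop.
by move=> h y; rewrite /Zop addrAC.
Qed.

Lemma iter_Zop_opp k g x :
  iter k Zop g x = iter k Xop (fun y => g (- y)) (- x).
Proof.
elim: k g x => [|k IH] g x; first by rewrite /= opprK.
rewrite !iterSr IH; apply: iter_XopE => y.
by rewrite /Zop /Xop opprD.
Qed.

Lemma iter_Zop_dif k g x : iter k Zop g x = iter k dif g (x - k%:Z).
Proof.
elim: k x => [|k IH] x; first by rewrite subr0.
by rewrite /= /Zop /dif !IH -addn1 PoszD; congr (_ - _);
   congr (iter _ _ _ _); ring.
Qed.

Lemma iter_dif_binom k j x :
  iter k dif (binom j) x = if (k <= j)%N then binom (j - k) x else 0.
Proof.
elim: k j x => [|k IH] j x; first by rewrite subn0.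
rewrite iterSr; case: j => [|j].
  rewrite (iter_difE _ (h := fun=> 0)) ?(iterop0 eq_dif dif_lin) // => y.
  by rewrite /dif !binom0 subrr.
rewrite (iter_difE _ (h := binom j)) ?IH // => y.
by rewrite /dif binomS; ring.
Qed.

Lemma binom00 j : binom j 0 = (j == 0%N)%:R.
Proof. by case: j => [|j]; [exact: binom0 | exact: (binom_small (j := 0))]. Qed.

(** Being a polynomial of degree less than [d], stated for functions known only at integers. *)
Definition polyfun d g := forall x, iter d dif g x = 0.

Lemma polyfunS d g : polyfun d g -> polyfun d.+1 g.
Proof. by move=> pg x /=; rewrite /dif !pg subrr. Qed.

Lemma polyfun_const d c : polyfun d.+1 (fun=> c).
Proof.
elim: d => [|d IH]; first by move=> x; rewrite /= /dif subrr.
exact: polyfunS.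
Qed.

Lemma polyfun_bin d j : (j < d)%N -> polyfun d (binom j).
Proof. by move=> ltjd x; rewrite iter_dif_binom leqNgt ltjd. Qed.

Lemma polyfun_ext d g h : g =1 h -> polyfun d g -> polyfun d h.
Proof. by move=> e pg x; rewrite -(iter_difE d e). Qed.

Lemma polyfun_shift d g m : polyfun d g -> polyfun d (fun x => g (x + m)).
Proof. by move=> pg x; rewrite iter_dif_shift. Qed.

Lemma polyfun_scale d c g : polyfun d g -> polyfun d (fun x => c * g x).
Proof. by move=> pg x; rewrite (iterop_scale eq_dif dif_lin) pg mulr0. Qed.

Lemma polyfun_add d g h : polyfun d g -> polyfun d h -> polyfun d (fun x => g x + h x).
Proof. by move=> pg ph x; rewrite (iterop_add eq_dif dif_lin) pg ph addr0. Qed.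

Lemma polyfun_sum d (I : Type) (r : seq I) (P : pred I) (G : I -> int -> rat) :
  (forall i, polyfun d (G i)) -> polyfun d (fun x => \sum_(i <- r | P i) G i x).
Proof.
by move=> pG x; rewrite (iterop_sum eq_dif dif_lin) big1 // => i _; apply: pG.
Qed.

Lemma polyfun_eq0 d g : polyfun d g -> (forall s, (s < d)%N -> iter s dif g 0 = 0) ->
  forall x, g x = 0.
Proof.
elim: d g => [|d IH] g pg g0; first exact: pg.
have d0 x : dif g x = 0.
  by apply: IH => [y|s lts]; rewrite -iterSr; [exact: pg|exact: g0].
have gS x : g (x + 1) = g x by apply/eqP; rewrite -subr_eq0; apply/eqP/d0.
have g00 : g 0 = 0 by exact: (g0 0%N).
move=> x; elim/int_ind: x => // m IHm; first by rewrite -addn1 PoszD gS.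
by rewrite -gS -addn1 PoszD opprD subrK.
Qed.

(** The difference of the two sides is again a [polyfun d], and all its differences at 0 vanish. *)
Lemma newton_X d g a w : polyfun d g ->
  g (a + w) = \sum_(s < d) iter s Xop g a * ((-1) ^+ s * binom s w).
Proof.
move=> pg; apply/eqP; rewrite -subr_eq0; apply/eqP.
pose c s := iter s Xop g a * (-1) ^+ s.
pose h w := -1 * (\sum_(s < d) c s * binom s w) + g (w + a).
transitivity (h w).
  rewrite /h mulN1r addrC (addrC a); congr (- _ + _).
  by apply: eq_bigr => s _; rewrite mulrA.
apply: (@polyfun_eq0 d) => [x|s ltsd].
  rewrite (iterop_lin eq_dif dif_lin) (iterop_sum eq_dif dif_lin) iter_dif_shift.
  rewrite pg addr0 big1 ?mulr0 // => s _.
  by rewrite (iterop_scale eq_dif dif_lin) iter_dif_binom leqNgt ltn_ord mulr0.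
rewrite (iterop_lin eq_dif dif_lin) (iterop_sum eq_dif dif_lin) iter_dif_shift.
rewrite add0r (bigD1 (Ordinal ltsd)) //= big1 => [|j nej].
  rewrite (iterop_scale eq_dif dif_lin) iter_dif_binom leqnn subnn binom0 /c.
  rewrite iter_Xop_dif; have := sqrr_sign rat s; rewrite expr2.
  set e := (-1) ^+ s => ee; rewrite !addr0 mulr1 mulrAC ee; ring.
rewrite (iterop_scale eq_dif dif_lin) iter_dif_binom.
case: leqP => hsj; last by rewrite mulr0.
rewrite binom00 subn_eq0 (_ : (j <= s)%N = false) ?mulr0 //.
by apply: contraNF nej => hjs; apply/eqP/val_inj/anti_leq; rewrite /= hsj hjs.
Qed.

Lemma gbinom_opp s (x : rat) :
  (-1) ^+ s * gbinom (- x) s = gbinom (x + s%:R - 1) s.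
Proof.
rewrite /gbinom mulrA; congr (_ / _).
rewrite -[X in (-1) ^+ X]card_ord -prodr_const -big_split /=.
rewrite [RHS](reindex_inj rev_ord_inj) /=; apply: eq_bigr => i _.
by rewrite natrB // -(natr1 i); ring.
Qed.

(** Reflecting the variable exchanges [Zop] and [Xop], which reduces this to [newton_X]. *)
Lemma newton_Z d g a w : polyfun d g ->
  g (a + w) = \sum_(s < d) iter s Zop g a * gbinom (w%:~R + s%:R - 1) s.
Proof.
move=> pg; pose h w := g (a - w).
have ph : polyfun d h.
  move=> x.
  have e : iter d dif h x = (-1) ^+ d * iter d Xop h x.
    by rewrite iter_Xop_dif mulrA -expr2 sqrr_sign mul1r.
  rewrite e.
  have -> : iter d Xop h x = iter d Zop g (a - x).
    rewrite iter_Zop_opp opprB.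
    rewrite -[x in LHS](subrK a) -(iter_Xop_shift d h a).
    apply: iter_XopE => y; rewrite /h; congr g; ring.
  by rewrite iter_Zop_dif pg mulr0.
have := newton_X 0 (- w) ph; rewrite add0r /h opprK => ->.
apply: eq_bigr => s _; rewrite -gbinom_opp /binom rmorphN /=; congr (_ * _).
rewrite iter_Zop_opp -[- a]add0r -(iter_Xop_shift s _ (- a)).
by apply: iter_XopE => y; congr g; ring.
Qed.

Lemma iter_Xop_coef d (c : nat -> rat) g (a : int) :
    (forall x, g x = \sum_(s < d) c s * ((-1) ^+ s * binom s (x - a))) ->
  forall s, (s < d)%N -> iter s Xop g a = c s.
Proof.
move=> gE s ltsd; rewrite iter_Xop_dif (iter_difE _ gE).
pose c' (i : nat) := c i * (-1) ^+ i.
rewrite (iter_difE _ (h := fun x => \sum_(i < d) c' i * binom i (x + - a))).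
  rewrite (iterop_sum eq_dif dif_lin) (bigD1 (Ordinal ltsd)) //= big1 => [|j nej].
    rewrite (iterop_scale eq_dif dif_lin) iter_dif_shift iter_dif_binom leqnn subnn.
    by rewrite binom0 addr0 mulr1 /c' mulrCA -expr2 sqrr_sign mulr1.
  rewrite (iterop_scale eq_dif dif_lin) iter_dif_shift iter_dif_binom.
  case: leqP => hsj; last by rewrite mulr0.
  rewrite subrr binom00 subn_eq0 (_ : (j <= s)%N = false) ?mulr0 //.
  by apply: contraNF nej => hjs; apply/eqP/val_inj/anti_leq; rewrite /= hsj hjs.
by move=> x; apply: eq_bigr => i _; rewrite mulrA.
Qed.

Lemma iter_Zop_coef d (c : nat -> rat) g (a : int) :
    (forall x, g x = \sum_(s < d) c s * gbinom ((x - a)%:~R + s%:R - 1) s) ->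
  forall s, (s < d)%N -> iter s Zop g a = c s.
Proof.
move=> gE s ltsd; rewrite iter_Zop_opp; apply: (@iter_Xop_coef d) => // x.
rewrite gE; apply: eq_bigr => i _; rewrite -gbinom_opp /binom -rmorphN.
by congr (_ * (_ * gbinom _%:~R _)); ring.
Qed.

Lemma polyfun_iter_Zop d g : polyfun d g -> forall x, iter d Zop g x = 0.
Proof. by move=> pg x; rewrite iter_Zop_dif pg. Qed.

(** Expanding each shifted determinant along the row of [x] leaves cofactors free of [x], hence a
    combination of shifted [binom j] with [j < n]. *)
Lemma polyfun_alphaL n s1 s2 : (size s1 + size s2).+1 = n ->
  polyfun n (fun x => alphaL n (s1 ++ x :: s2)).
Proof.
move=> sz; rewrite /alphaL /shift_act; apply: polyfun_sum => m; apply: polyfun_scale.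
have lti : (size s1 < n)%N by rewrite -sz ltnS leq_addr.
pose i := Ordinal lti.
pose A x := \matrix_(k, j < n) binom j ((rowl n (s1 ++ x :: s2) + mrow m) 0 k).
have cof x j : cofactor (A x) i j = cofactor (A 0) i j.
  rewrite /cofactor; congr (_ * \det _); apply/matrixP => a b; rewrite !mxE.
  congr (binom _ (_ + _)); rewrite !nth_cat; case: ltnP => // le1.
  have ne : i != lift i a by exact: neq_lift.
  case e : (_ - _)%N => [|k] //; exfalso; move/eqP: e; rewrite subn_eq0 => le2.
  by move: ne; rewrite -val_eqE /= eqn_leq; rewrite le1 le2.
apply: (polyfun_ext (g := fun x => \sum_(j < n) cofactor (A 0) i j * binom j (x + (m i)%:Z))).
  move=> x; rewrite /Ddet (expand_det_row _ i); apply: eq_bigr => j _.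
  by rewrite cof mulrC !mxE nth_cat /= ltnn subnn.
by apply: polyfun_sum => j; apply/polyfun_scale/polyfun_shift/polyfun_bin.
Qed.

(** * Fischer's recursion *)

(** Normalised to 0 at 0 and continued to negative integers so that [antidifS] holds everywhere. *)
Definition antidif (g : int -> rat) (x : int) : rat :=
  match x with
  | Posz m => \sum_(i < m) g i%:Z
  | Negz m => - \sum_(i < m.+1) g (- (i.+1)%:Z)
  end.

Lemma antidifS g x : antidif g (x + 1) = antidif g x + g x.
Proof.
case: x => [m|[|m]].
- by rewrite -PoszD addn1 /= big_ord_recr.
- by rewrite (_ : Negz 0 + 1 = 0) //= big_ord0 big_ord_recl big_ord0 addr0 addNr.
- rewrite (_ : Negz m.+1 + 1 = Negz m); last by rewrite !NegzE; lia.
  by rewrite /= [in RHS]big_ord_recr /= NegzE opprD addrNK.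
Qed.

Lemma antidif_diff g x : antidif (fun l => g (l + 1) - g l) x = g x - g 0.
Proof.
elim/int_ind: x => [|m IH|m IH]; first by rewrite /= big_ord0 subrr.
  by rewrite -addn1 PoszD antidifS IH; ring.
have := antidifS (fun l => g (l + 1) - g l) (- (m.+1)%:Z).
by rewrite -addn1 PoszD opprD !addrNK IH; lra.
Qed.

Lemma antidif_lin c g h x :
  antidif (fun l => c * g l + h l) x = c * antidif g x + antidif h x.
Proof.
by case: x => m /=; rewrite big_split /= -mulr_sumr //; ring.
Qed.

Lemma eq_antidif g h x : g =1 h -> antidif g x = antidif h x.
Proof. by move=> e; case: x => m /=; rewrite (eq_bigr _ (fun i _ => e _)). Qed.

(* The sum of [g l] over [L <= l < b]; when [b < L] it is minus the sum over
   [b <= l < L], so that it is additive in the bounds. *)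
Definition ssum (L b : int) (g : int -> rat) : rat := antidif g b - antidif g L.

Lemma eq_ssum L b g h : g =1 h -> ssum L b g = ssum L b h.
Proof. by move=> e; rewrite /ssum !(eq_antidif _ e). Qed.

Lemma ssum_lin L b c g h :
  ssum L b (fun l => c * g l + h l) = c * ssum L b g + ssum L b h.
Proof. by rewrite /ssum !antidif_lin; ring. Qed.

Lemma ssumxx L g : ssum L L g = 0.
Proof. exact: subrr. Qed.

Lemma ssum_recl L b g : ssum L b g = g L + ssum (L + 1) b g.
Proof. by rewrite /ssum antidifS; ring. Qed.

Lemma ssum_recr L b g : ssum L (b + 1) g = ssum L b g + g b.
Proof. by rewrite /ssum antidifS; ring. Qed.

Lemma ssum_diff L b g : ssum L b (fun l => g (l + 1) - g l) = g b - g L.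
Proof. by rewrite /ssum !antidif_diff; ring. Qed.

(* Signed sum of [A] over the strictly increasing rows interlacing [L :: ks]:
   either [L <= l < b], and the next entry is at least [b], or [l = b], and it is
   at least [b + 1].  The signs make this polynomial in [L] and [ks]. *)
Fixpoint rowsum (L : int) (ks : seq int) (A : seq int -> rat) : rat :=
  if ks is b :: r then
    ssum L b (fun l => rowsum b r (A \o cons l)) + rowsum (b + 1) r (A \o cons b)
  else A [::].

Lemma eq_rowsum L ks A B : (forall t, size t = size ks -> A t = B t) ->
  rowsum L ks A = rowsum L ks B.
Proof.
elim: ks L A B => [|b r IH] L A B e /=; first exact: e.
congr (_ + _); last by apply: IH => t st; apply: e; rewrite /= st.
by apply: eq_ssum => l; apply: IH => t st; apply: e; rewrite /= st.
Qed.

Lemma rowsum_lin L ks c A B :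
  rowsum L ks (fun t => c * A t + B t) = c * rowsum L ks A + rowsum L ks B.
Proof.
elim: ks L A B => [|b r IH] L A B //=.
rewrite [X in _ + X](IH _ (A \o cons b) (B \o cons b)).
under eq_ssum => l do rewrite (IH _ (A \o cons l) (B \o cons l)).
rewrite ssum_lin; ring.
Qed.

(** The alternating sum of [alphaL_sum], arranged to follow the recursion of [rowsum]: the leading
    term omits [L] and shifts all the rest, the other terms keep [L] as first entry. *)
Fixpoint altsum (L : int) (ks : seq int) (U : seq int -> rat) : rat :=
  if ks is b :: r then
    U [seq y + 1 | y <- b :: r] - altsum b r (U \o cons L)
  else U [::].

Lemma eq_altsum L ks A B : (forall t, size t = size ks -> A t = B t) ->
  altsum L ks A = altsum L ks B.
Proof.
elim: ks L A B => [|b r IH] L A B e /=; first exact: e.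
congr (_ - _); first by apply: e; rewrite /= size_map.
by apply: IH => t st; apply: e; rewrite /= st.
Qed.

Lemma altsum_lin L ks c A B :
  altsum L ks (fun t => c * A t + B t) = c * altsum L ks A + altsum L ks B.
Proof.
elim: ks L A B => [|b r IH] L A B //=.
by rewrite (IH _ (A \o cons L) (B \o cons L)); ring.
Qed.

Lemma altsum0 L ks A : (forall t, size t = size ks -> A t = 0) ->
  altsum L ks A = 0.
Proof.
move=> e; have := altsum_lin L ks (-1) A A.
rewrite (eq_altsum L (B := A)) => [|t st]; first by lra.
by rewrite e //; ring.
Qed.

Lemma altsumE L ks U : altsum L ks U = \sum_(p < (size ks).+1) (-1) ^+ p *
  U (mkseq (fun j => if (j < p)%N then (L :: ks)`_j else (L :: ks)`_j.+1 + 1)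
           (size ks)).
Proof.
elim: ks L U => [|b r IH] L U.
  by rewrite big_ord_recl big_ord0 mul1r addr0.
rewrite big_ord_recl mul1r /= IH; congr (_ + _).
  congr U; apply: (@eq_from_nth _ 0) => [|i]; first by rewrite size_mkseq /= size_map.
  rewrite /= size_map => hi; rewrite nth_mkseq //=.
  by case: i hi => [|i] //= hi; rewrite (nth_map 0).
rewrite -sumrN; apply: eq_bigr => p _; rewrite /= -mulNr -mulN1r -exprS.
congr (_ * U _); rewrite /mkseq /=; congr (_ :: _).
rewrite -[1%N]addn0 iotaDl -map_comp; apply: eq_map => j /=.
by rewrite add1n.
Qed.

Definition locally_sym m (U : seq int -> rat) := forall s1 b s2,
  size (s1 ++ b :: b :: s2) = m ->
  U (s1 ++ b :: b :: s2) - U (s1 ++ b :: (b + 1) :: s2)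
  + U (s1 ++ (b + 1) :: (b + 1) :: s2) = 0.

(* The sum over the first entry telescopes; local symmetry removes the terms in
   which two neighbouring entries have moved to the same [b]. *)
Lemma rowsum_eachvar L ks U : locally_sym (size ks) U ->
  rowsum L ks (eachvar (-1) 1 U) = altsum L ks U.
Proof.
elim: ks L U => [|b r IH] L U loc //=.
have IHl M l : rowsum M r (eachvar (-1) 1 U \o cons l) =
    altsum M r (U \o cons (l + 1)) - altsum M r (U \o cons l).
  rewrite (eq_rowsum _ (B := fun t => -1 * eachvar (-1) 1 (U \o cons l) t +
      eachvar (-1) 1 (U \o cons (l + 1)) t)) => [|t _ /=]; last by rewrite mul1r.
  have locl x : locally_sym (size r) (U \o cons x).
    by move=> s1 c s2 sz; apply: (loc (x :: s1) c s2); rewrite /= sz.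
  by rewrite rowsum_lin !IH //; ring.
under eq_ssum => l do rewrite IHl.
rewrite (ssum_diff L b (fun l => altsum b r (U \o cons l))) IHl.
suff : altsum b r (U \o cons b) - altsum (b + 1) r (U \o cons b) +
    altsum (b + 1) r (U \o cons (b + 1)) = U ((b + 1) :: [seq y + 1 | y <- r]).
  by lra.
case: r {IH IHl} loc => [|c r] loc /=; first by rewrite subrr add0r.
suff : altsum c r (fun t => -1 * U (b :: (b + 1) :: t) +
   (U (b :: b :: t) + U ((b + 1) :: (b + 1) :: t))) = 0.
  rewrite (altsum_lin c r (-1) (fun t => U (b :: (b + 1) :: t))).
  rewrite (eq_altsum c (A := fun t => U (b :: b :: t) + U ((b + 1) :: (b + 1) :: t))
    (B := fun t => 1 * U (b :: b :: t) +
      U ((b + 1) :: (b + 1) :: t))); last by move=> t _; rewrite mul1r.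
  rewrite (altsum_lin c r 1 (fun t => U (b :: b :: t))).
  rewrite -/(U \o cons b \o cons b); lra.
apply: altsum0 => t st; have := loc [::] b t; rewrite /= st => /(_ erefl).
by lra.
Qed.

(* Fischer's recursion, at arbitrary integers. *)
Lemma alphaL_rec n x ks : size ks = n -> alphaL n.+1 (x :: ks) = rowsum x ks (alphaL n).
Proof.
move=> sz; rewrite (eq_rowsum x (B := eachvar (-1) 1 (antialphaL n))); last first.
  by move=> t; rewrite sz; exact: alphaL_antialphaL.
rewrite rowsum_eachvar; last by rewrite sz => s1 b s2; exact: antialphaL_local.
by rewrite altsumE alphaL_sum sz.
Qed.

(** Raising the lower bound from [x] loses exactly the rows that start with [x]. *)
Lemma rowsum_headX x c r G :
  rowsum x (c :: r) G - rowsum (x + 1) (c :: r) G = rowsum c r (G \o cons x).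
Proof. by rewrite /= [ssum x _ _]ssum_recl; ring. Qed.

Lemma rowsum_rcons L ks z A :
  rowsum L (rcons ks z) A =
  rowsum L (rcons ks (z - 1)) A + rowsum L ks (fun t => A (rcons t z)).
Proof.
elim: ks L A => [|b r IH] L A /=.
  by rewrite -{1}(subrK 1 z) ssum_recr.
rewrite IH; under eq_ssum => l do rewrite IH -[X in X + _]mul1r.
by rewrite ssum_lin mul1r; ring.
Qed.

(** Between two equal bounds the last entry is forced to be [b], and strictness keeps the one before
    it at most [b - 1]. *)
Lemma rowsum_rcons2 L ks b A :
  rowsum L (rcons (rcons ks b) b) A =
  rowsum L (rcons ks (b - 1)) (fun t => A (rcons t b)).
Proof.
elim: ks L A => [|k r IH] L A /=.
  under eq_ssum => l do rewrite ssumxx add0r.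
  rewrite -{1}(subrK 1 b) ssum_recr -addrA; congr (_ + _) => /=.
  by rewrite /ssum antidifS /=; ring.
by rewrite IH; congr (_ + _); apply: eq_ssum => l; rewrite IH.
Qed.

(** The value 0 on the empty list is the one for which [nodesum_rcons] holds there. *)
Definition nodesum (A : seq int -> rat) (ks : seq int) : rat :=
  if ks is b :: r then rowsum b r A else 0.

Lemma eq_nodesum A B ks : (forall t, (size t).+1 = size ks -> A t = B t) ->
  nodesum A ks = nodesum B ks.
Proof.
by case: ks => [|b r] //= e; apply: eq_rowsum => t st; apply: e; rewrite st.
Qed.

Lemma nodesum_lin c A B ks :
  nodesum (fun t => c * A t + B t) ks = c * nodesum A ks + nodesum B ks.
Proof. by case: ks => [|b r] /=; [rewrite mulr0 addr0|exact: rowsum_lin]. Qed.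

Lemma nodesum0 A ks : (forall t, (size t).+1 = size ks -> A t = 0) ->
  nodesum A ks = 0.
Proof.
move=> e; have := nodesum_lin (-1) A A ks.
rewrite (eq_nodesum (B := A)) => [|t st]; first by lra.
by rewrite e //; ring.
Qed.

Lemma nodesum_rcons ks z A :
  nodesum A (rcons ks z) =
  nodesum A (rcons ks (z - 1)) + nodesum (fun t => A (rcons t z)) ks.
Proof. by case: ks => [|b r] /=; [rewrite addr0|exact: rowsum_rcons]. Qed.

Lemma nodesum_rcons2 ks b A :
  nodesum A (rcons (rcons ks b) b) =
  nodesum (fun t => A (rcons t b)) (rcons ks (b - 1)).
Proof.
case: ks => [|k r] /=; last exact: rowsum_rcons2.
by rewrite ssumxx add0r.
Qed.

Lemma eachvar_rcons a b h s x : eachvar a b h (rcons s x) =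
  eachvar a b (fun t => a * h (rcons t x) + b * h (rcons t (x + 1))) s.
Proof. by elim: s h => [|y s IH] h //=; rewrite !IH. Qed.

Lemma eachvar_lin a b c g h s :
  eachvar a b (fun t => c * g t + h t) s = c * eachvar a b g s + eachvar a b h s.
Proof.
elim: s g h => [|y s IH] g h //=.
rewrite (IH (g \o cons y) (h \o cons y)).
by rewrite (IH (g \o cons (y + 1)) (h \o cons (y + 1))); ring.
Qed.

(** * Signed sums below a run of consecutive integers *)

Definition interval (a : int) (m : nat) : seq int := mkseq (fun i => a + i%:Z) m.

Lemma interval0 a : interval a 0 = [::]. Proof. by []. Qed.

Lemma size_interval a m : size (interval a m) = m.
Proof. exact: size_mkseq. Qed.

Lemma intervalS a m : interval a m.+1 = rcons (interval a m) (a + m%:Z).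
Proof. by rewrite /interval mkseqS. Qed.

Definition triple0 m (A : seq int -> rat) := forall s1 b s2,
  size (s1 ++ b :: b :: b :: s2) = m -> A (s1 ++ b :: b :: b :: s2) = 0.

Lemma triple0_rcons m A x : triple0 m.+1 A -> triple0 m (fun t => A (rcons t x)).
Proof.
move=> tA s1 b s2 sz; rewrite rcons_cat /=; apply: tA.
by move: sz; rewrite !size_cat /= size_rcons => <-; rewrite !addnS.
Qed.

Section ShiftedInterval.
Variable q : rat.

(** The appended bound repeats the last entry. If that entry is not shifted (weight [q]), the entry
    below is forced and the same situation recurs one place to the left. If it is shifted, the last
    two bounds decrease, and the signed sum is minus a sum of values of [A] at rows ending in two
    equal entries, which are 0 by hypothesis. *)
Lemma eachvar_interval_tight a m A : triple0 m A ->
    (forall s, (size s).+2 = m ->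
      A (rcons (rcons s (a + m%:Z)) (a + m%:Z)) = 0) ->
  eachvar q (1 - q) (fun t => nodesum A (rcons t (a + m%:Z - 1))) (interval a m) =
  q ^+ m * A (interval a m).
Proof.
elim: m A => [|m IH] A tA A0; first by rewrite interval0 /= mul1r.
rewrite intervalS eachvar_rcons; set x := a + m%:Z.
have xS : a + m.+1%:Z = x + 1 by rewrite -addn1 PoszD addrA.
rewrite xS addrK exprS -mulrA -(IH (fun t => A (rcons t x))).
- rewrite -[RHS]addr0 -(mulr0 0) -/x.
  rewrite (@eq_eachvar _ _ _ (fun t => q * nodesum (fun t => A (rcons t x)) (rcons t (x - 1)) + 0)).
    rewrite eachvar_lin; congr (_ + _).
    by elim: (interval a m) => [|y s IHs] /=; rewrite ?mulr0 // !IHs !mulr0 addr0.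
  move=> t; rewrite size_interval => st; rewrite nodesum_rcons2; congr (_ + _).
  have := nodesum_rcons (rcons t (x + 1)) (x + 1) A.
  rewrite addrK nodesum_rcons2 addrK => e.
  have := nodesum_rcons t (x + 1) (fun t => A (rcons t (x + 1))).
  rewrite addrK => e'.
  rewrite (_ : nodesum A _ = - nodesum (fun t => A (rcons (rcons t (x + 1)) (x + 1))) t).
    rewrite nodesum0 ?oppr0 ?mulr0 // => u su; rewrite -xS A0 //.
    by rewrite su st.
  by lra.
- exact: triple0_rcons.
move=> s ss; rewrite -!cats1 -!catA /=; apply: tA.
by rewrite size_cat /= addn3 ss.
Qed.

Lemma eachvar_interval a m A : triple0 m A ->
  eachvar q (1 - q) (fun t => nodesum A (rcons t (a + m%:Z))) (interval a m) =
  \sum_(j < m.+1) q ^+ j *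
    A (interval a j ++ interval (a + j%:Z + 1) (m - j)).
Proof.
elim: m A => [|m IH] A tA.
  by rewrite big_ord_recl big_ord0 /= !interval0 /= mul1r addr0.
rewrite intervalS eachvar_rcons; set x := a + m%:Z.
have xS : a + m.+1%:Z = x + 1 by rewrite -addn1 PoszD addrA.
rewrite xS.
rewrite (@eq_eachvar _ _ _ (fun t => q * nodesum (fun t => A (rcons t x)) (rcons t (x - 1))
    + nodesum (fun t => A (rcons t (x + 1))) (rcons t x))); last first.
  move=> t _; rewrite nodesum_rcons addrK nodesum_rcons2.
  by rewrite nodesum_rcons2 addrK; ring.
rewrite eachvar_lin eachvar_interval_tight; first last.
- move=> s ss; rewrite -!cats1 -!catA /=; apply: tA.
  by rewrite size_cat /= addn3 ss.
- exact: triple0_rcons.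
rewrite IH; last exact: triple0_rcons.
rewrite [RHS]big_ord_recr (_ : nat_of_ord ord_max = m.+1) // subnn cats0.
rewrite addrC intervalS -/x; congr (_ + _).
  apply: eq_bigr => j _ /=; congr (_ * A _); have lej : (j <= m)%N by rewrite -ltnS.
  rewrite rcons_cat subSn //.
  rewrite intervalS; congr (_ ++ rcons _ _).
  by rewrite /x -subzn //; ring.
by rewrite exprS mulrA.
Qed.

End ShiftedInterval.

(** * The inner coefficients *)

Lemma coef_eq0_of_eval n (c : nat -> rat) :
  (forall q, \sum_(i < n) q ^+ i * c i = 0) -> forall i, (i < n)%N -> c i = 0.
Proof.
move=> c0 i ltin; pose p := \poly_(i < n) c i.
suff p0 : p = 0 by have := coef_poly n c i; rewrite -/p p0 coef0 ltin.
apply/eqP; apply: contraT => pn0.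
have := max_poly_roots (rs := [seq k%:R | k <- iota 0 (size p)]) pn0.
rewrite size_map size_iota ltnn; apply.
  apply/allP => _ /mapP [k _ ->]; rewrite /root /p horner_poly -[X in _ == X](c0 k%:R).
  by apply/eqP/eq_bigr => j _; rewrite mulrC.
by rewrite map_inj_uniq ?iota_uniq // => x y /eqP; rewrite eqr_nat => /eqP.
Qed.

Lemma eachvar_scale a b c h s : eachvar a b (fun t => c * h t) s = c * eachvar a b h s.
Proof.
by elim: s h => [|y s IH] h //=; rewrite (IH (h \o cons y)) (IH (h \o cons (y + 1))); ring.
Qed.

Lemma eachvar_add a b g h s : eachvar a b (fun t => g t + h t) s = eachvar a b g s + eachvar a b h s.
Proof.
rewrite -[eachvar a b g s]mul1r -eachvar_lin; apply: eq_eachvar => t _; ring.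
Qed.

Lemma eachvar_corner a b g1 g2 g3 g4 s :
  eachvar a b g1 s - eachvar a b g2 s - eachvar a b g3 s + eachvar a b g4 s =
  eachvar a b (fun t => g1 t - g2 t - g3 t + g4 t) s.
Proof.
elim: s g1 g2 g3 g4 => [|y s IH] g1 g2 g3 g4 //=.
rewrite -(IH (g1 \o cons y) (g2 \o cons y) (g3 \o cons y) (g4 \o cons y)).
rewrite -(IH (g1 \o cons (y + 1)) (g2 \o cons (y + 1)) (g3 \o cons (y + 1))
             (g4 \o cons (y + 1))); ring.
Qed.

Lemma polyfun_eachvar d a b (h : seq int -> int -> rat) s :
  (forall t, size t = size s -> polyfun d (h t)) ->
  polyfun d (fun y => eachvar a b (h ^~ y) s).
Proof.
elim: s h => [|x s IH] h ph /=; first exact: ph.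
by apply: polyfun_add; apply: polyfun_scale;
   [apply: (IH (fun t => h (x :: t)))|apply: (IH (fun t => h (x + 1 :: t)))] => t st;
   apply: ph; rewrite /= st.
Qed.

(* Differences in the outer variables freeze the first and last entries of the
   next row. *)
Lemma alphaL_corner n x z ks : size ks = n ->
  alphaL n.+2 (x :: rcons ks z) - alphaL n.+2 (x + 1 :: rcons ks z)
  - alphaL n.+2 (x :: rcons ks (z - 1)) + alphaL n.+2 (x + 1 :: rcons ks (z - 1)) =
  nodesum (fun l => alphaL n.+1 (x :: rcons l z)) ks.
Proof.
move=> sz; rewrite !alphaL_rec ?size_rcons ?sz // ![rowsum _ (rcons ks z) _]rowsum_rcons.
set u := rowsum x (rcons _ _) _; set v := rowsum (x + 1) (rcons _ _) _.
case: ks {sz u v} (u) (v) => [|c r] u v /=; first by ring.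
rewrite -(rowsum_headX x c r (fun t => alphaL n.+1 (rcons t z))) /=; ring.
Qed.

Section TopRows.
Variable m : nat.
Local Notation n := m.+3.

Definition inner x z l : rat := alphaL m.+2 (x :: rcons l z).

(* The integers from [2] to [m + 2] without [k]. *)
Definition hole (k : nat) : seq int :=
  interval 2 (k - 2) ++ interval (k%:Z + 1) (m.+2 - k).

(** Extension by 0 matches the matrices: when the 1s of the outer columns lie below the top row, the
    1 of the top row is in an inner column. *)
Definition Hval (k : nat) (x z : int) : rat :=
  if (2 <= k <= m.+2)%N then inner x z (hole k) else 0.

(** [q + (1 - q) E] in the two outer variables, so that [eachvar] has only the entries of [l] left
    to run over. *)
Definition mixed q x z l : rat :=
  q * (q * inner x z l + (1 - q) * inner x (z + 1) l) +
  (1 - q) * (q * inner (x + 1) z l + (1 - q) * inner (x + 1) (z + 1) l).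

Lemma nodesum_mixed q x z ks :
  nodesum (mixed q x z) ks =
  q * (q * nodesum (inner x z) ks + (1 - q) * nodesum (inner x (z + 1)) ks) +
  (1 - q) * (q * nodesum (inner (x + 1) z) ks
             + (1 - q) * nodesum (inner (x + 1) (z + 1)) ks).
Proof.
rewrite /mixed; case: ks => [|b r] /=; first by ring.
have S c A : rowsum b r (fun t => c * A t) = c * rowsum b r A.
  have := rowsum_lin b r c A (fun=> 0).
  rewrite [rowsum b r (fun=> 0)](_ : _ = 0); last first.
    have := nodesum0 (A := fun=> 0) (ks := b :: r); exact.
  by rewrite addr0 => <-; apply: eq_rowsum => t _; rewrite addr0.
by rewrite rowsum_lin S rowsum_lin S rowsum_lin S.
Qed.

(** By [alphaL_corner] this is a mixed difference of [alphaL n] in the outer variables, which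
    commutes with the operators that leave [alphaL n] invariant. *)
Lemma nodesum_inner_eachvar q x z ks : size ks = m.+1 ->
  nodesum (inner x z) ks = eachvar q (1 - q) (nodesum (mixed q x z)) ks.
Proof.
move=> sz; pose a x z k := alphaL n (x :: rcons k z).
pose b x z k := q * (q * a x z k + (1 - q) * a x (z + 1) k) +
  (1 - q) * (q * a (x + 1) z k + (1 - q) * a (x + 1) (z + 1) k).
have abE x' z' : alphaL n (x' :: rcons ks z') = eachvar q (1 - q) (b x' z') ks.
  rewrite -(@alphaL_eachvar n q) /= ?size_rcons ?sz // !eachvar_rcons.
  by rewrite -!eachvar_scale -eachvar_add.
rewrite -alphaL_corner // !abE eachvar_corner; apply: eq_eachvar => k sk; rewrite sz in sk.
rewrite nodesum_mixed -!alphaL_corner // /b /a ?addrK ?subrK; ring.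
Qed.

Lemma triple0_mixed q x z : triple0 m (mixed q x z).
Proof.
move=> s1 c s2 sz.
have i0 x' z' : inner x' z' (s1 ++ c :: c :: c :: s2) = 0.
  rewrite /inner rcons_cat -cat_cons !rcons_cons; apply: alphaL_triple.
  by move: sz; rewrite !size_cat /= size_rcons => <-; rewrite !addnS.
by rewrite /mixed !i0; ring.
Qed.

Lemma polyfun_nodesum_mixed q x z k : size k = m ->
  polyfun n (fun y => nodesum (mixed q x z) (rcons k y)).
Proof.
move=> sk.
have pa x' z' : polyfun n (fun y => alphaL n (x' :: rcons (rcons k y) z')).
  apply: (polyfun_ext (g := fun y => alphaL n ((x' :: k) ++ y :: [:: z']))).
    by move=> y; rewrite -cats1 -cats1 -catA.
  by apply: polyfun_alphaL; rewrite /= sk addn1.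
have pi x' z' : polyfun n (fun y => nodesum (inner x' z') (rcons k y)).
  apply: (polyfun_ext (g := fun y => alphaL n (x' :: rcons (rcons k y) z') +
    (-1 * alphaL n (x' + 1 :: rcons (rcons k y) z') +
    (-1 * alphaL n (x' :: rcons (rcons k y) (z' - 1)) +
     alphaL n (x' + 1 :: rcons (rcons k y) (z' - 1)))))).
    by move=> y; rewrite -alphaL_corner ?size_rcons ?sk //; ring.
  by repeat first [exact: pa | apply: polyfun_add | apply: polyfun_scale].
apply: (polyfun_ext (fun y => esym (nodesum_mixed q x z (rcons k y)))).
by repeat first [exact: pi | apply: polyfun_add | apply: polyfun_scale].
Qed.

Definition inner_coef (i : nat) (x z : int) : rat :=
  iter i Zop (fun y => nodesum (inner x z) (rcons (interval 2 m) y)) m.+1%:Z.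

(* [q + (1 - q) E = E (1 - q Z)], so summing [q ^+ i * Z ^ i] undoes the
   operator in the last variable up to a shift. *)
Lemma inner_coef_gen q x z :
  \sum_(i < n) q ^+ i * inner_coef i x z =
  \sum_(j < m.+1) q ^+ j * mixed q x z (hole (j + 2)).
Proof.
pose psi y := eachvar q (1 - q) (fun k => nodesum (mixed q x z) (rcons k y)) (interval 2 m).
have ppsi : polyfun n psi.
  by apply: polyfun_eachvar => k; rewrite size_interval; exact: polyfun_nodesum_mixed.
pose psi1 y := psi (y + 1).
have E y : nodesum (inner x z) (rcons (interval 2 m) y) =
    - q * Zop psi1 y + psi1 y.
  rewrite (nodesum_inner_eachvar q) ?size_rcons ?size_interval // eachvar_rcons eachvar_add !eachvar_scale.
  by rewrite -/(psi y) -/(psi (y + 1)) /Zop /psi1 subrK; ring.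
have gE i : inner_coef i x z = - q * iter i.+1 Zop psi1 m.+1%:Z + iter i Zop psi1 m.+1%:Z.
  by rewrite /inner_coef (iter_ZopE _ E) (iterop_lin eq_Zop Zop_lin) -iterSr.
have tel k : \sum_(i < k) q ^+ i * inner_coef i x z =
    psi1 m.+1%:Z - q ^+ k * iter k Zop psi1 m.+1%:Z.
  elim: k => [|k IH]; first by rewrite big_ord0 mul1r subrr.
  by rewrite big_ord_recr IH gE exprSr /=; ring.
rewrite tel polyfun_iter_Zop; last exact: polyfun_shift.
rewrite mulr0 subr0 /psi1 (_ : m.+1%:Z + 1 = 2 + m%:Z); last by lia.
apply: (etrans (eachvar_interval q 2 (@triple0_mixed q x z))).
apply: eq_bigr => j _; congr (_ * _).
by rewrite /hole addnK PoszD (addrC j%:Z) addn2.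
Qed.

Lemma inner_coefE i x z : (i < n)%N ->
  inner_coef i x z = Hval i.+2 (x + 1) (z + 1)
    + (Hval i.+1 x (z + 1) + Hval i.+1 (x + 1) z
       - (Hval i.+1 (x + 1) (z + 1) + Hval i.+1 (x + 1) (z + 1)))
    + (Hval i x z - Hval i x (z + 1) - Hval i (x + 1) z
       + Hval i (x + 1) (z + 1)).
Proof.
(* [A], [B] and [C] are the coefficients of 1, q and q^2 in [(q + (1 - q) E_x) (q + (1 - q) E_z)]
   applied to [Hval]. *)
pose A i := Hval i (x + 1) (z + 1).
pose B i := Hval i x (z + 1) + Hval i (x + 1) z - (A i + A i).
pose C i := Hval i x z - Hval i x (z + 1) - Hval i (x + 1) z + A i.
move=> lti; change (inner_coef i x z = A i.+2 + B i.+1 + C i).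
apply/eqP; rewrite -subr_eq0; apply/eqP; move: i lti.
apply: coef_eq0_of_eval => q.
under eq_bigr => i _ do rewrite mulrBr mulrDr mulrDr.
rewrite sumrB !big_split /= inner_coef_gen.
have z0 i : (i < 2)%N || (m.+2 < i)%N -> forall x z, Hval i x z = 0.
  by move=> h x' z'; rewrite /Hval ifF //; apply/negbTE; lia.
have A0 i : (i < 2)%N || (m.+2 < i)%N -> A i = 0 by move=> h; rewrite /A z0.
have B0 i : (i < 2)%N || (m.+2 < i)%N -> B i = 0.
  by move=> h; rewrite /B A0 // !z0 // !addr0 subrr.
have C0 i : (i < 2)%N || (m.+2 < i)%N -> C i = 0.
  by move=> h; rewrite /C A0 // !z0 // !subr0 addr0.
(* In these three sums the index becomes the hole [j + 2]; the terms dropped have an index outside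
   2, ..., m + 2, where [Hval] is 0. *)
have -> : \sum_(i < m.+3) q ^+ i * A i.+2 = \sum_(j < m.+1) q ^+ j * A (j + 2)%N.
  rewrite big_ord_recr big_ord_recr /= !A0 ?mulr0 ?addr0; try lia.
  by apply: eq_bigr => j _; rewrite addn2.
have -> : \sum_(i < m.+3) q ^+ i * B i.+1 = \sum_(j < m.+1) q ^+ j * (q * B (j + 2)%N).
  rewrite big_ord_recr big_ord_recl /= !B0 ?mulr0 ?addr0 ?add0r; try lia.
  by apply: eq_bigr => j _; rewrite addn2 /bump /= add1n exprSr mulrA.
have -> : \sum_(i < m.+3) q ^+ i * C i = \sum_(j < m.+1) q ^+ j * (q * (q * C (j + 2)%N)).
  rewrite big_ord_recl big_ord_recl /= !C0 ?mulr0 ?addr0 ?add0r // ?/bump //=.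
  by apply: eq_bigr => j _; rewrite addn2 /bump /= !add1n !exprSr !mulrA.
rewrite -!big_split -sumrB /=; apply: big1 => j _.
have hj : (2 <= j + 2 <= m.+2)%N by have := ltn_ord j; lia.
by rewrite /mixed /A /B /C /A /Hval hj; ring.
Qed.

End TopRows.

(** * Newton expansion in three variables *)

Section Commutation.
Variables (op1 op2 : (int -> rat) -> int -> rat) (al be : rat) (c : int).
Hypothesis eq_op1 : forall g h, g =1 h -> op1 g =1 op1 h.
Hypothesis op1_lin : forall c g h x,
  op1 (fun y => c * g y + h y) x = c * op1 g x + op1 h x.
Hypothesis op2E : forall g x, op2 g x = al * g x + be * g (x + c).

Lemma iterop_comm k l (g : int -> int -> rat) a b :
  iter k op1 (fun y => iter l op2 (g ^~ y) a) b =
  iter l op2 (fun x => iter k op1 (g x) b) a.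
Proof.
have eq_op2 g1 g2 : g1 =1 g2 -> op2 g1 =1 op2 g2.
  by move=> e x; rewrite !op2E !e.
elim: l g a => [|l IH] g a //=.
rewrite op2E -!IH -(iterop_scale eq_op1 op1_lin k be).
rewrite -(iterop_lin eq_op1 op1_lin).
by apply: (eq_iterop eq_op1) => y; rewrite op2E.
Qed.

End Commutation.

Lemma XopE g x : Xop g x = 1 * g x + -1 * g (x + 1).
Proof. by rewrite /Xop; ring. Qed.
Lemma ZopE g x : Zop g x = 1 * g x + -1 * g (x + -1).
Proof. by rewrite /Zop; ring. Qed.

Section Expansion.
Variables (d : nat) (a b : int) (g : int -> int -> int -> rat).

Definition coef3 s i t : rat :=
  iter t Zop (fun z => iter i Zop (fun y => iter s Xop (fun x => g x y z) a) b) b.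

(** The backward Newton basis at [b]. With [b = n - 2] and [i] counted from 0 it is the factor
    binom(y - n + i + 1, i) of the expansion. *)
Definition back (y : int) i : rat := gbinom ((y - b)%:~R + i%:R - 1) i.

Lemma expansion3 x y z :
    (forall y z, polyfun d (fun x => g x y z)) ->
    (forall x z, polyfun d (fun y => g x y z)) ->
    (forall x y, polyfun d (fun z => g x y z)) ->
  g x y z = \sum_(s < d) \sum_(i < d) \sum_(t < d)
    coef3 s i t * ((-1) ^+ s * binom s (x - a)) * back y i * back z t.
Proof.
move=> px py pz.
have := newton_X a (x - a) (px y z); rewrite subrKC => ->; apply: eq_bigr => s _.
pose u z y := iter s Xop (fun x => g x y z) a.
have pu z' : polyfun d (u z').
  move=> y'; rewrite (iterop_comm eq_dif dif_lin XopE _ s (fun x y => g x y z')).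
  rewrite (iter_XopE _ (h := fun=> 0)); first exact: (iterop0 eq_Xop Xop_lin).
  by move=> x'; rewrite py.
have := newton_Z b (y - b) (pu z); rewrite subrKC /u => ->.
rewrite mulr_suml; apply: eq_bigr => i _.
pose w z := iter i Zop (u z) b.
have pw : polyfun d w.
  move=> z'; rewrite (iterop_comm eq_dif dif_lin ZopE _ i (fun y z => u z y)).
  rewrite (iter_ZopE _ (h := fun=> 0)); first exact: (iterop0 eq_Zop Zop_lin).
  move=> y'; rewrite (iterop_comm eq_dif dif_lin XopE _ s (fun x z => g x y' z)).
  rewrite (iter_XopE _ (h := fun=> 0)); first exact: (iterop0 eq_Xop Xop_lin).
  by move=> x'; rewrite pz.
have := newton_Z b (z - b) pw; rewrite subrKC /w /u => ->.
rewrite !mulr_suml; apply: eq_bigr => t _.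
by rewrite /coef3 /back; ring.
Qed.

Lemma coef3_unique (c : nat -> nat -> nat -> rat) :
    (forall x y z, g x y z = \sum_(s < d) \sum_(i < d) \sum_(t < d)
      c s i t * ((-1) ^+ s * binom s (x - a)) * back y i * back z t) ->
  forall s i t, (s < d)%N -> (i < d)%N -> (t < d)%N -> coef3 s i t = c s i t.
Proof.
move=> gE s i t lts lti ltt.
pose v s y z := \sum_(i < d) \sum_(t < d) c s i t * back y i * back z t.
have E1 y z : iter s Xop (fun x => g x y z) a = v s y z.
  apply: (@iter_Xop_coef d (fun s => v s y z)) => // x.
  rewrite gE; apply: eq_bigr => j _; rewrite mulr_suml; apply: eq_bigr => k _.
  by rewrite mulr_suml; apply: eq_bigr => l _; ring.
have E2 z : iter i Zop (fun y => iter s Xop (fun x => g x y z) a) b =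
    \sum_(t < d) c s i t * back z t.
  apply: (@iter_Zop_coef d (fun i => \sum_(t < d) c s i t * back z t)) => // y.
  rewrite E1 /v; apply: eq_bigr => j _; rewrite mulr_suml; apply: eq_bigr => k _.
  by rewrite -/(back y j); ring.
by apply: (@iter_Zop_coef d (c s i)) => // z; rewrite E2.
Qed.

End Expansion.

Lemma expansionP n (c : nat -> nat -> nat -> rat) : is_expansion n c <->
  forall x y z, alpha (@kvec n x y z) =
    \sum_(s < n) \sum_(i < n) \sum_(t < n)
      c s.+1 i.+1 t.+1 * ((-1) ^+ s * binom s (x - 2)) * back (n%:Z - 2) y i
        * back (n%:Z - 2) z t.
Proof.
have E (x y z : int) : \sum_(s < n) \sum_(i < n) \sum_(t < n)
      c s.+1 i.+1 t.+1 * (-1) ^+ (s.+2) * gbinom (x%:~R - 2) s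
        * gbinom (y%:~R - n%:R + (i.+1)%:R) i
        * gbinom (z%:~R - n%:R + (t.+1)%:R) t =
    \sum_(s < n) \sum_(i < n) \sum_(t < n)
      c s.+1 i.+1 t.+1 * ((-1) ^+ s * binom s (x - 2)) * back (n%:Z - 2) y i
        * back (n%:Z - 2) z t.
  apply: eq_bigr => s _; apply: eq_bigr => i _; apply: eq_bigr => t _.
  have e (w : int) j : back (n%:Z - 2) w j = gbinom (w%:~R - n%:R + (j.+1)%:R) j.
    rewrite /back; congr gbinom; rewrite -(natr1 j) !rmorphB /= -!pmulrn; ring.
  by rewrite !e /binom rmorphB /= !exprS; ring.
by split=> h x y z; rewrite h E.
Qed.

Lemma alpha_kvec m x y z :
  alpha (@kvec m.+3 x y z) = alphaL m.+3 (x :: rcons (rcons (interval 2 m) y) z).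
Proof.
rewrite alpha_act /alphaL; congr shift_act; apply/rowP => i; rewrite !mxE /kvec.
case: i => [[|i]] //= lti; rewrite eqSS nth_rcons size_rcons size_interval.
case: eqP => [->|/eqP ne]; first by rewrite ltnn.
rewrite nth_rcons size_interval eqSS (_ : (i < m.+1)%N); last by lia.
case: eqP => [->|/eqP ne2]; first by rewrite ltnn.
have ltim : (i < m)%N by lia.
by rewrite ltim /interval nth_mkseq //; lia.
Qed.

Section TopRowsCoefficients.
Variable m : nat.
Local Notation n := m.+3.

Definition Hcoef s k t : rat :=
  iter t Zop (fun z => iter s Xop (fun x => Hval m k x z) 2) (m.+2)%:Z.

Definition diff2 s t (h : int -> int -> rat) : rat :=
  iter t Zop (fun z => iter s Xop (h ^~ z) 2) (m.+2)%:Z.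

Lemma eq_diff2 s t h h' : (forall x z, h x z = h' x z) -> diff2 s t h = diff2 s t h'.
Proof.
by move=> e; apply: iter_ZopE => z; apply: iter_XopE => x; exact: e.
Qed.

Lemma diff2_lin s t c g h :
  diff2 s t (fun x z => c * g x z + h x z) = c * diff2 s t g + diff2 s t h.
Proof.
rewrite /diff2 -(iterop_lin eq_Zop Zop_lin); apply: iter_ZopE => z.
exact: (iterop_lin eq_Xop Xop_lin).
Qed.

Lemma diff2_X s t h :
  diff2 s.+1 t h = diff2 s t h - diff2 s t (fun x z => h (x + 1) z).
Proof.
rewrite addrC -mulN1r -diff2_lin; apply: iter_ZopE => z; rewrite iterSr.
by apply: iter_XopE => x; rewrite /Xop; ring.
Qed.

Lemma diff2_Z s t h :
  diff2 s t.+1 h = diff2 s t h - diff2 s t (fun x z => h x (z - 1)).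
Proof.
rewrite addrC -[- diff2 _ _ _]mulN1r -diff2_lin /diff2 iterSr; apply: iter_ZopE => z.
rewrite /Zop addrC -[- iter _ _ _ _]mulN1r -(iterop_lin eq_Xop Xop_lin).
by apply: iter_XopE => x.
Qed.

(** One [Xop] and one [Zop] are spent on the corner difference. The argument [z - 1] moves the base
    point from n - 2, used by the expansion, to n - 1, used by [Hcoef]. *)
Lemma coef3_inner_coef s i t :
  coef3 2 (n%:Z - 2) (fun x y z => alpha (@kvec n x y z)) s.+1 i t.+1 =
  diff2 s t (fun x z => inner_coef m i x (z - 1)).
Proof.
rewrite /coef3 (_ : n%:Z - 2 = m.+1%:Z); last by lia.
pose g x y z := alpha (@kvec n x y z).
pose Ga x z := iter i Zop (fun y => g x y z) m.+1%:Z.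
rewrite (iter_ZopE _ (h := fun z => iter s.+1 Xop (Ga ^~ z) 2)); last first.
  by move=> z; rewrite -(iterop_comm eq_Zop Zop_lin XopE _ s.+1 (fun x y => g x y z)).
rewrite /diff2 iterSr.
have -> : m.+2%:Z = m.+1%:Z + 1 by lia.
rewrite -(iter_Zop_shift _ _ 1); apply: iter_ZopE => z; rewrite addrK.
rewrite /Zop addrC -[- iter _ _ _ _]mulN1r -(iterop_lin eq_Xop Xop_lin) iterSr.
apply: iter_XopE => x; rewrite /Xop /inner_coef.
transitivity (iter i Zop (fun y => -1 * g x y (z - 1) + (1 * g (x + 1) y (z - 1) +
    (-1 * g (x + 1) y z + g x y z))) m.+1%:Z).
  by rewrite !(iterop_lin eq_Zop Zop_lin) /Ga; ring.
apply: iter_ZopE => y; rewrite -alphaL_corner ?size_rcons ?size_interval //.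
by rewrite /g !alpha_kvec; ring.
Qed.

(** Writing E_x = 1 - X and E_z^(-1) = 1 - Z turns [inner_coefE] into (1 - X) H_(i+2) + (X - Z + X
    Z) H_(i+1) - X Z H_i, the six terms of the theorem. *)
Lemma coef3_Hcoef s i t : (i < n)%N ->
  coef3 2 (n%:Z - 2) (fun x y z => alpha (@kvec n x y z)) s.+1 i t.+1 =
  Hcoef s.+1 i.+1 t + Hcoef s.+1 i.+1 t.+1 + Hcoef s i.+2 t
  - Hcoef s.+1 i.+2 t - Hcoef s i.+1 t.+1 - Hcoef s.+1 i t.+1.
Proof.
move=> lti; rewrite coef3_inner_coef.
pose A k x z := Hval m k (x + 1) z.
pose B k x z := Hval m k x (z - 1).
pose C k x z := Hval m k (x + 1) (z - 1).
rewrite (@eq_diff2 _ _ _ (fun x z => 1 * A i.+2 x z + (1 * Hval m i.+1 x z +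
   (1 * C i.+1 x z + (-2 * A i.+1 x z + (1 * B i x z + (-1 * Hval m i x z +
   (-1 * C i x z + A i x z)))))))); last first.
  by move=> x z; rewrite inner_coefE // subrK /A /B /C; ring.
rewrite !diff2_lin.
have HX s' k t' : Hcoef s'.+1 k t' = diff2 s' t' (Hval m k) - diff2 s' t' (A k).
  exact: diff2_X.
have HZ k : Hcoef s k t.+1 = diff2 s t (Hval m k) - diff2 s t (B k).
  exact: diff2_Z.
have HXZ k : Hcoef s.+1 k t.+1 = diff2 s t (Hval m k) - diff2 s t (A k)
    - (diff2 s t (B k) - diff2 s t (C k)).
  by rewrite /Hcoef -/(diff2 _ _ (Hval m k)) diff2_Z !diff2_X.
rewrite !HXZ !HX !HZ -[Hcoef _ i.+2 _]/(diff2 s t (Hval m i.+2)).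
move: (diff2 s t) => d.
move: (d (Hval m i)) (d (Hval m i.+1)) (d (Hval m i.+2)) (d (A i)) (d (A i.+1))
  (d (A i.+2)) (d (B i)) (d (B i.+1)) (d (C i)) (d (C i.+1)) => *.
ring.
Qed.

End TopRowsCoefficients.

(** * Counting paths of rows *)

Fixpoint sumb (n : nat) (F : seq bool -> rat) : rat :=
  if n is k.+1 then sumb k (F \o cons false) + sumb k (F \o cons true)
  else F [::].

Lemma eq_sumb n F G : (forall d, size d = n -> F d = G d) -> sumb n F = sumb n G.
Proof.
elim: n F G => [|n IH] F G e /=; first exact: e.
by congr (_ + _); apply: IH => d sd; apply: e; rewrite /= sd.
Qed.

Lemma sumb0 n : sumb n (fun=> 0) = 0.
Proof. by elim: n => //= n IH; rewrite IH addr0. Qed.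

(* [scan st d d' e]: the row [d - d'] has partial sums in {0, 1} when started
   from [st], and reaches [e]. *)
Fixpoint scan (st : bool) (d d' : seq bool) (e : bool) : bool :=
  match d, d' with
  | [::], [::] => st == e
  | x :: d, y :: d' =>
      if x == y then scan st d d' e
      else if x then ~~ st && scan true d d' e else st && scan false d d' e
  | _, _ => false
  end.

Fixpoint pos (j : int) (d : seq bool) : seq int :=
  if d is x :: d then (if x then cons j else id) (pos (j + 1) d) else [::].

Lemma size_pos j d : size (pos j d) = count id d.
Proof. by elim: d j => //= -[] d IH j /=; rewrite IH. Qed.

Lemma pos_cat j d1 d2 : pos j (d1 ++ d2) = pos j d1 ++ pos (j + (size d1)%:Z) d2.
Proof.
elim: d1 j => [|x d1 IH] j /=; first by rewrite addr0.
have -> : j + (size d1).+1%:Z = j + 1 + (size d1)%:Z by lia.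
by rewrite IH; case: x.
Qed.

Lemma pos_nseq j k : pos j (nseq k true) = interval j k.
Proof.
elim: k => // k IH; rewrite -addn1 nseqD pos_cat IH size_nseq /= cats1.
by rewrite addn1 intervalS.
Qed.

Lemma scan_count st d d' e : scan st d d' e ->
  (count id d' + e = count id d + st)%N.
Proof.
elim: d d' st => [|x d IH] [|y d'] st //=; first by move/eqP->.
by case: x; case: y => //=; [move/IH|case: st => // /IH|case: st => // /IH|move/IH]; lia.
Qed.

Lemma rowsum_step j ks h :
  rowsum (j + 1) ks h + nodesum (h \o cons j) ks = rowsum j ks h.
Proof.
case: ks => [|c r]; first by rewrite /= addr0.
by rewrite /nodesum -rowsum_headX; ring.
Qed.

(** In state [true] an entry of the upper row has been passed and the next lower entry may lie in
    column [j] or later, as in [rowsum j]; in state [false] it must wait for the next upper entry,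
    as in [nodesum]. Ending in [false] calls for one more lower entry, bounded by the last
    column. *)
Lemma sumb_scan st e d j h :
  sumb (size d) (fun d' => (scan st d d' e)%:R * h (pos j d')) =
  let ks := pos j d ++ (if e then [::] else [:: j + (size d)%:Z - 1]) in
  if st then rowsum j ks h else nodesum h ks.
Proof.
elim: d st j h => [|x d IH] st j h /=.
  case: st; case: e => /=; rewrite ?mul1r ?mul0r ?addr0 //.
  have := ssum_recr j (j - 1) (fun l => h [:: l]).
  by rewrite subrK ssumxx.
have sT : j + (size d).+1%:Z = j + 1 + (size d)%:Z by lia.
rewrite sT; set T := if e then _ else _.
have IHj st' h' : sumb (size d) (fun d' => (scan st' d d' e)%:R * h' (pos (j + 1) d')) =
  if st' then rowsum (j + 1) (pos (j + 1) d ++ T) h'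
  else nodesum h' (pos (j + 1) d ++ T) by rewrite IH.
have Z : sumb (size d) (fun d' => 0 * h (pos j d')) = 0.
  by rewrite -[RHS](sumb0 (size d)); apply: eq_sumb => d' _; rewrite mul0r.
rewrite /comp /=; case: x => /=; case: st => /=.
- by rewrite (IHj true (h \o cons j)) ssumxx add0r -[RHS]add0r; congr (_ + _);
     apply: etrans Z; apply: eq_sumb => d' _; rewrite !mul0r.
- by rewrite (IHj true h) (IHj false (h \o cons j)) rowsum_step.
- by rewrite (IHj true h) (IHj false (h \o cons j)) rowsum_step.
- by rewrite (IHj false h) -[RHS]addr0; congr (_ + _);
     apply: etrans Z; apply: eq_sumb => d' _; rewrite !mul0r.
Qed.

Section Paths.
Variable N : nat.

(* A row is encoded by the bits of its [N] inner columns.  [paths r a b m] counts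
   the sequences of [r] further rows starting at [m] in which the leftmost resp.
   rightmost column is occupied in exactly the first [a] resp. [b] rows. *)
Fixpoint paths (r a b : nat) (m : seq bool) : rat :=
  if r is r'.+1 then
    sumb N (fun m' => (scan (a == 1%N) m m' (b != 1%N))%:R * paths r' a.-1 b.-1 m')
  else [&& a == 0%N, b == 0%N & m == nseq N false]%:R.

Definition lastdiff b r (s : seq int) : rat :=
  if b is b'.+1 then iter b' Zop (fun z => alphaL r (rcons s z)) N.+1%:Z else alphaL r s.

Definition enddiff a b r (s : seq int) : rat :=
  if a is a'.+1 then iter a' Xop (fun x => lastdiff b r (x :: s)) 2
  else lastdiff b r s.

(** For [b = 1] the right outer column is occupied in the present row but not in the next, whose
    last entry can then be anything up to the last inner column [N + 1]. *)
Definition lastpos b : seq int := if b != 1%N then [::] else [:: N.+1%:Z].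

Lemma alphaL0 s : alphaL 0 s = 1.
Proof.
rewrite /alphaL /Wpoly big_pred0 => [|[[]]] //; rewrite act1 /Ddet.
by rewrite det_mx00.
Qed.

Lemma iter_rowsum (op : (int -> rat) -> int -> rat) al be c k L ks
    (A : int -> seq int -> rat) a :
    (forall g x, op g x = al * g x + be * g (x + c)) ->
  iter k op (fun z => rowsum L ks (A z)) a =
  rowsum L ks (fun t => iter k op (A ^~ t) a).
Proof.
move=> opE.
have eq_op g1 g2 : g1 =1 g2 -> op g1 =1 op g2.
  by move=> e x; rewrite !opE !e.
elim: k A a => [|k IH] A a //; rewrite iterSr.
rewrite (eq_iterop eq_op k (h := fun z => rowsum L ks (fun t => op (A ^~ t) z))).
  by rewrite IH; apply: eq_rowsum => t _; rewrite iterSr.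
move=> z; rewrite opE.
have sc x : be * rowsum L ks (A x) = rowsum L ks (fun t => be * A x t).
  have := rowsum_lin L ks be (A x) (fun=> 0); have := rowsum_lin L ks 1 (fun=> 0) (fun=> 0).
  rewrite (eq_rowsum L (B := fun=> 0)) => [|t _]; last by rewrite mulr0 addr0.
  move=> e0; rewrite (_ : rowsum L ks (fun=> 0) = 0); last by lra.
  by rewrite addr0 => <-; apply: eq_rowsum => t _; rewrite addr0.
by rewrite sc -rowsum_lin; apply: eq_rowsum => t _; rewrite opE.
Qed.

Lemma iter_nodesum (op : (int -> rat) -> int -> rat) al be c k ks
    (A : int -> seq int -> rat) a :
    (forall g x, op g x = al * g x + be * g (x + c)) ->
  iter k op (fun z => nodesum (A z) ks) a =
  nodesum (fun t => iter k op (A ^~ t) a) ks.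
Proof.
case: ks => [|b r] opE /=; last exact: (iter_rowsum _ _ _ _ _ opE).
elim: k a => [|k IH] a //=; rewrite opE !IH; ring.
Qed.

Lemma lastdiff_rec b r x s : (size s + (0 < b) = r)%N ->
  lastdiff b r.+1 (x :: s) = rowsum x (s ++ lastpos b) (lastdiff b.-1 r).
Proof.
case: b => [|[|b]] /= sz; rewrite ?cats0 ?cats1.
- by rewrite alphaL_rec // -sz addn0.
- by rewrite alphaL_rec // size_rcons -sz addn1.
rewrite -iterS iterSr (iter_ZopE _ (h := fun z =>
    rowsum x s (fun t => alphaL r (rcons t z)))); last first.
  move=> z; rewrite /Zop !alphaL_rec ?size_rcons -?sz ?addn1 //.
  by rewrite [in X in X - _]rowsum_rcons; ring.
exact: (iter_rowsum _ _ _ _ _ ZopE).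
Qed.

(* [enddiff a b] takes [a - 1] differences at [2] in a new first variable and
   [b - 1] at [N + 1] in a new last one, and matches [paths] row by row. *)
Lemma enddiff_rec a b r ks : (size ks + (0 < a) + (0 < b) = r.+1)%N ->
  enddiff a b r.+1 ks =
  if a == 1%N then rowsum 2 (ks ++ lastpos b) (enddiff a.-1 b.-1 r)
  else nodesum (enddiff a.-1 b.-1 r) (ks ++ lastpos b).
Proof.
case: a => [|[|a]] /= sz.
- case: ks sz => [|x s] sz; last by rewrite /= lastdiff_rec //; move: sz => /=; lia.
  have r0 : r = 0%N by move: sz; case: (0 < b)%N => /=; lia.
  rewrite r0; case: b sz => [|[|b]] //= _; first by rewrite alphaL_rec //.
  rewrite -iterS iterSr (iter_ZopE _ (h := fun=> 0)); first exact: (iterop0 eq_Zop Zop_lin).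
  by move=> z; rewrite /Zop !alphaL_rec //= !alphaL0 subrr.
- by rewrite lastdiff_rec //; lia.
rewrite -iterS iterSr (iter_XopE _ (h := fun x =>
    nodesum (lastdiff b.-1 r \o cons x) (ks ++ lastpos b))); last first.
  move=> x; rewrite /Xop !lastdiff_rec; try lia.
  case: (ks ++ lastpos b) => [|c s]; first by rewrite /= subrr.
  exact: rowsum_headX.
exact: (iter_nodesum _ _ _ _ XopE).
Qed.

Lemma pathsE r a b m : size m = N ->
    (size (pos 2 m) + (0 < a) + (0 < b) = r)%N ->
  paths r a b m = enddiff a b r (pos 2 m).
Proof.
elim: r a b m => [|r IH] a b m sm.
  case: a b => [|a] [|b]; rewrite /= ?addnS ?addn0 ?addn1 // => /eqP.
  rewrite size_pos -leqn0 leqNgt -has_count => nh.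
  rewrite (_ : m == nseq N false) ?alphaL0 //; apply/eqP; rewrite -sm.
  elim: m nh {sm} => //= -[] m IHm //= nh; by rewrite -IHm.
move=> sz /=; rewrite enddiff_rec // -[in LHS]sm.
rewrite (eq_sumb (G := fun m' => (scan (a == 1%N) m m' (b != 1%N))%:R *
    enddiff a.-1 b.-1 r (pos 2 m'))); last first.
  move=> m' sm'; case sc : (scan _ _ _ _); last by rewrite !mul0r.
  rewrite IH ?sm' //; move/scan_count: sc; rewrite !size_pos in sz *.
  by move: sz; case: a => [|[|a]]; case: b => [|[|b]] /=; lia.
rewrite sumb_scan /lastpos sm (_ : 2 + N%:Z - 1 = N.+1%:Z) //.
Qed.

End Paths.

Definition holebits (N k : nat) : seq bool := mkseq (fun i => i.+2 != k) N.

Lemma pos_holebits m k : (2 <= k <= m.+2)%N ->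
  pos 2 (holebits m.+1 k) = hole m k.
Proof.
move=> hk.
have -> : holebits m.+1 k = nseq (k - 2) true ++ false :: nseq (m.+2 - k) true.
  apply: (@eq_from_nth _ false) => [|i].
    by rewrite size_mkseq size_cat /= !size_nseq; lia.
  rewrite size_mkseq => lti; rewrite nth_mkseq // nth_cat size_nseq nth_nseq.
  case: ltnP => h; first by lia.
  case e : (i - (k - 2))%N => [|l] /=; first by lia.
  by rewrite nth_nseq; case: ltnP; lia.
rewrite pos_cat /= !pos_nseq size_nseq /hole; congr (_ ++ interval _ _).
lia.
Qed.

Lemma paths_Hcoef m s k t : (2 <= k <= m.+2)%N ->
  paths m.+1 m.+2 s.+1 t.+1 (holebits m.+1 k) = Hcoef m s k t.
Proof.
move=> hk; rewrite pathsE ?size_mkseq // pos_holebits //; last first.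
  by rewrite /hole size_cat !size_interval; lia.
rewrite /Hcoef /enddiff /lastdiff.
rewrite (iterop_comm eq_Zop Zop_lin XopE _ s (fun x z => Hval m k x z)).
by apply: iter_XopE => x; apply: iter_ZopE => z; rewrite /Hval hk.
Qed.

(** * Alternating sign matrices as paths of rows *)

Definition psum (w : nat -> int) (l : nat) : int := \sum_(j < l) w j.

Lemma psum0 w : psum w 0 = 0. Proof. exact: big_ord0. Qed.
Lemma psumS w l : psum w l.+1 = psum w l + w l.
Proof. exact: big_ord_recr. Qed.

Definition prefix01 n w :=
  (forall l, (l <= n)%N -> psum w l = 0 \/ psum w l = 1) /\ psum w n = 1.

Definition alternating n w :=
  [/\ forall j, (j < n)%N -> [\/ w j = -1, w j = 0 | w j = 1], psum w n = 1 &
      forall j1 j2, (j1 < j2 < n)%N -> w j1 <> 0 -> w j2 <> 0 ->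
        (forall j, (j1 < j < j2)%N -> w j = 0) -> w j2 = - w j1].

Lemma prefix01_alternating n w : prefix01 n w -> alternating n w.
Proof.
case=> pw p1; split=> //.
  move=> j ltj; have := pw _ (ltnW ltj); have := pw _ ltj; rewrite psumS => h1 h2.
  have : w j = -1 \/ w j = 0 \/ w j = 1 by lia.
  by case=> [|[]]; [constructor 1|constructor 2|constructor 3].
move=> j1 j2 /andP [lt12 lt2] n1 n2 z.
have e k : (j1 + k.+1 <= j2)%N -> psum w (j1 + k.+1) = psum w j1.+1.
  elim: k => [|k IH] lek; first by rewrite addn1.
  rewrite addnS psumS IH; last by lia.
  by rewrite z ?addr0 //; lia.
have := e (j2 - j1.+1)%N; rewrite (_ : (j1 + (j2 - j1.+1).+1 = j2)%N); last by lia.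
move=> /(_ (leqnn _)) e2.
have := pw j1; have := pw j1.+1; have := pw j2.+1; rewrite !psumS e2 psumS.
lia.
Qed.

Lemma alternating_prefix01 n w : alternating n w -> prefix01 n w.
Proof.
case=> w3 p1 alt; split=> // l leln.
(* The state at [m] once a first nonzero entry [e] has been met: [j0] is the latest nonzero entry,
   and alternation keeps the partial sum at [e] or 0. *)
pose J e m := exists j0, [/\ (j0 < m)%N, w j0 <> 0,
  forall j, (j0 < j < m)%N -> w j = 0 &
  (psum w m = e /\ w j0 = e) \/ (psum w m = 0 /\ w j0 = - e)].
have Jstep e m : (m < n)%N -> J e m -> J e m.+1.
  move=> ltm [j0 [lt0 n0 z0 c]].
  have [wm0|wmn] := eqVneq (w m) 0.
    exists j0; split; rewrite ?psumS ?wm0 ?addr0 //; first exact: ltnW.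
    move=> j hj; have [->//|ne] := eqVneq j m; apply: z0; lia.
  have := alt j0 m; rewrite lt0 ltm => /(_ isT n0 (elimN eqP wmn) z0) wE.
  exists m; split; rewrite ?psumS //; first by apply/eqP.
    by move=> j; lia.
  by case: c => [[-> w0]|[-> w0]]; [right|left]; rewrite wE w0; split; ring.
have Jmono e m k : (m + k <= n)%N -> J e m -> J e (m + k)%N.
  elim: k => [|k IH] le Jm; first by rewrite addn0.
  by rewrite addnS; apply: Jstep; [lia|apply: IH => //; lia].
have tri m : (m <= n)%N ->
    [\/ psum w m = 0 /\ (forall j, (j < m)%N -> w j = 0), J 1 m | J (-1) m].
  elim: m => [|m IH] ltm; first by constructor 1; split; first exact: psum0.
  case: (IH (ltnW ltm)) => [[p0 z]|Jm|Jm].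
  - case: (w3 m ltm) => wm.
    + constructor 3; exists m; rewrite wm psumS p0 wm; split=> //; first by move=> j; lia.
      by left.
    + constructor 1; rewrite psumS p0 wm; split=> // j ltj.
      by have [->//|ne] := eqVneq j m; apply: z; lia.
    + constructor 2; exists m; rewrite wm psumS p0 wm; split=> //; first by move=> j; lia.
      by left.
  - by constructor 2; apply: Jstep.
  - by constructor 3; apply: Jstep.
case: (tri l leln) => [[-> _]|[j0 [_ _ _ [[-> _]|[-> _]]]]|Jl]; [by left|by right|by left|].
(* A first nonzero entry -1 would persist to [n] and make the total -1 or 0 instead of 1. *)
have := Jmono _ _ (n - l)%N _ Jl; rewrite subnKC // => /(_ (leqnn _)).
by case=> j0 [_ _ _]; rewrite p1 => -[[]|[]].
Qed.

Lemma is_ASM_prefix n (A : 'M[int]_n) (W : nat -> nat -> int) :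
  (forall i j : 'I_n, A i j = W i j) ->
  is_ASM A <-> (forall i, (i < n)%N -> prefix01 n (W i)) /\
               (forall j, (j < n)%N -> prefix01 n (W^~ j)).
Proof.
move=> AW.
have sumE (F : 'I_n -> int) (w : nat -> int) : (forall i, F i = w i) -> (\sum_i F i == 1) = (psum w n == 1).
  by move=> e; congr (_ == _); apply: eq_bigr.
split.
  case/andP => /andP [/andP [/andP [/forallP h1 /forallP h2] /forallP h3] /forallP h4] /forallP h5.
  have m3 i j : [\/ A i j = -1, A i j = 0 | A i j = 1].
    by move/forallP: (h1 i) => /(_ j); rewrite !inE => /or3P [] /eqP;
      [constructor 1|constructor 2|constructor 3].
  split=> k ltk; apply: alternating_prefix01; split.
  - by move=> j ltj; have := m3 (Ordinal ltk) (Ordinal ltj); rewrite AW.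
  - by apply/eqP; rewrite -(sumE _ _ (AW (Ordinal ltk))).
  - move=> j1 j2 /andP [lt12 lt2] n1 n2 z.
    have lt1 := ltn_trans lt12 lt2.
    move/forallP: (h4 (Ordinal ltk)) => /(_ (Ordinal lt1)) /forallP /(_ (Ordinal lt2)).
    rewrite !AW /= lt12; move/eqP: (n1) => ->; move/eqP: (n2) => -> /=.
    move/implyP => H; apply/eqP/H/forallP => j; apply/implyP => hj.
    by rewrite AW /= z.
  - by move=> j ltj; have := m3 (Ordinal ltj) (Ordinal ltk); rewrite AW.
  - by apply/eqP; rewrite -(sumE _ _ (fun i => AW i (Ordinal ltk))).
  - move=> j1 j2 /andP [lt12 lt2] n1 n2 z.
    have lt1 := ltn_trans lt12 lt2.
    move/forallP: (h5 (Ordinal ltk)) => /(_ (Ordinal lt1)) /forallP /(_ (Ordinal lt2)).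
    rewrite !AW /= lt12; move/eqP: (n1) => ->; move/eqP: (n2) => -> /=.
    move/implyP => H; apply/eqP/H/forallP => j; apply/implyP => hj.
    by rewrite AW /= z.
case=> hr hc.
have ar i ltin := prefix01_alternating (hr i ltin).
have ac j ltjn := prefix01_alternating (hc j ltjn).
apply/andP; split; first (apply/andP; split; first (apply/andP; split; first (apply/andP; split))).
- apply/forallP => i; apply/forallP => j; rewrite !inE AW.
  by case: (ar i (ltn_ord i)) => /(_ j (ltn_ord j)) [] -> _ _.
- apply/forallP => i; rewrite (sumE _ _ (AW i)).
  by case: (ar i (ltn_ord i)) => _ -> _.
- apply/forallP => j; have := sumE (fun i => A i j) (W^~ j) (fun i => AW i j); rewrite /= => ->.
  by case: (ac j (ltn_ord j)) => _ -> _.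
- apply/forallP => i; apply/forallP => j1; apply/forallP => j2; apply/implyP.
  case/and4P => lt12 /eqP n1 /eqP n2 /forallP z; apply/eqP; move: n1 n2; rewrite !AW => n1 n2.
  case: (ar i (ltn_ord i)) => _ _ /(_ j1 j2); rewrite lt12 ltn_ord; apply=> // j hj.
  have ltj : (j < n)%N by move: (ltn_ord j2); lia.
  by have := z (Ordinal ltj); rewrite /= hj AW => /eqP.
- apply/forallP => i; apply/forallP => j1; apply/forallP => j2; apply/implyP.
  case/and4P => lt12 /eqP n1 /eqP n2 /forallP z; apply/eqP; move: n1 n2; rewrite !AW => n1 n2.
  case: (ac i (ltn_ord i)) => _ _ /(_ j1 j2); rewrite lt12 ltn_ord; apply=> // j hj.
  have ltj : (j < n)%N by move: (ltn_ord j2); lia.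
  by have := z (Ordinal ltj); rewrite /= hj AW => /eqP.
Qed.

Lemma psum_unique n w j0 : (forall j, (j < n)%N -> 0 <= w j) -> psum w n = 1 ->
    (j0 < n)%N -> w j0 = 1 ->
  forall u, (u <= n)%N -> psum w u = (j0 < u)%N%:Z.
Proof.
move=> w0 w1 lt0 e0.
have z j : (j < n)%N -> j != j0 -> w j = 0.
  move=> ltj ne; move: w1; rewrite /psum (bigD1 (Ordinal lt0)) //= e0.
  move=> /(congr1 (fun x => x - 1)); rewrite addrAC subrr add0r.
  move/psumr_eq0P => H; have := H _ (Ordinal ltj); apply=> //.
  by move=> i _; apply: w0.
elim=> [|u IH] leu; first by rewrite psum0.
rewrite psumS IH; last exact: ltnW.
have [->|ne] := eqVneq u j0; first by rewrite ltnn ltnS leqnn e0.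
by rewrite z // addr0; congr Posz; lia.
Qed.

Lemma scanP st d d' e : size d = size d' ->
  scan st d d' e <->
  (forall l, (l <= size d)%N ->
     st%:Z + psum (fun j => (nth false d j)%:Z - (nth false d' j)%:Z) l = 0 \/
     st%:Z + psum (fun j => (nth false d j)%:Z - (nth false d' j)%:Z) l = 1) /\
  st%:Z + psum (fun j => (nth false d j)%:Z - (nth false d' j)%:Z) (size d) = e%:Z.
Proof.
elim: d d' st => [|x d IH] [|y d'] st //= sz.
  split.
    by move/eqP=> ->; split=> [[|l]|] //; rewrite ?psum0 ?addr0 //; case: e; [right|left].
  by rewrite psum0 addr0 => -[_]; case: st; case: e.
have {}sz : size d = size d' by case: sz.
set w := fun j => _; pose w' j := (nth false d j)%:Z - (nth false d' j)%:Z.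
have wS l : psum w l.+1 = (x%:Z - y%:Z) + psum w' l.
  by rewrite /psum big_ord_recl.
have E (st' : bool) : st%:Z + (x%:Z - y%:Z) = st'%:Z ->
    scan st' d d' e <->
    (forall l, (l <= (size d).+1)%N -> st%:Z + psum w l = 0 \/ st%:Z + psum w l = 1) /\
    st%:Z + psum w (size d).+1 = e%:Z.
  move=> es; rewrite (IH d' st' sz) wS addrA es; split=> -[h1 h2]; split=> //.
    case=> [|l] lel; last by rewrite wS addrA es; apply: h1.
    by rewrite psum0 addr0; case: (st); [right|left].
  by move=> l lel; have := h1 l.+1 lel; rewrite wS addrA es.
have F : (forall st' : bool, st%:Z + (x%:Z - y%:Z) <> st'%:Z) ->
    ~ ((forall l, (l <= (size d).+1)%N -> st%:Z + psum w l = 0 \/ st%:Z + psum w l = 1) /\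
    st%:Z + psum w (size d).+1 = e%:Z).
  move=> ne [h _]; have := h 1%N isT; rewrite wS psum0 addr0.
  by case=> e1; [apply: (ne false)|apply: (ne true)].
case: (x) (y) (st) E F => [] [] [] E F /=; try exact: E;
  by split => // H; exfalso; apply: F H => -[].
Qed.

Lemma sum_tupleS (T : finType) r (F : seq T -> rat) :
  \sum_(p : r.+1.-tuple T) F p = \sum_x \sum_(p : r.-tuple T) F (x :: p).
Proof.
rewrite pair_big /= (reindex (fun xp : T * r.-tuple T => cons_tuple xp.1 xp.2)) //=.
exists (fun p => (thead p, behead_tuple p)) => [[x p] _|p _] /=.
  by congr (_, _); apply/val_inj.
by apply/val_inj; rewrite /= [in RHS](tuple_eta p).
Qed.

Lemma sum_tuple0 (T : finType) (F : seq T -> rat) :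
  \sum_(p : 0.-tuple T) F p = F [::].
Proof.
by rewrite (big_pred1 [tuple]) // => p; apply/esym/eqP; exact: tuple0.
Qed.

Lemma sumbE N F : sumb N F = \sum_(d : N.-tuple bool) F d.
Proof.
elim: N F => [|N IH] F /=; first by rewrite sum_tuple0.
by rewrite sum_tupleS big_bool /= !IH addrC.
Qed.

Section Paths.
Variable N : nat.

Fixpoint is_path (a b : nat) (m : seq bool) (p : seq (seq bool)) : bool :=
  if p is m' :: p' then
    scan (a == 1%N) m m' (b != 1%N) && is_path a.-1 b.-1 m' p'
  else [&& a == 0%N, b == 0%N & m == nseq N false].

Lemma paths_card r a b m :
  paths N r a b m =
  #|[set p : r.-tuple (N.-tuple bool) | is_path a b m (map val p)]|%:R.
Proof.
rewrite -sum1_card natr_sum big_mkcond /=.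
transitivity (\sum_(p : r.-tuple (N.-tuple bool)) (is_path a b m (map val p))%:R : rat).
  elim: r a b m => [|r IH] a b m /=.
    by rewrite (sum_tuple0 (fun p => (is_path a b m (map val p))%:R)).
  rewrite (sum_tupleS _ (fun p => (is_path a b m (map val p))%:R)) sumbE.
  apply: eq_bigr => m' _; rewrite IH mulr_sumr; apply: eq_bigr => p _ /=.
  by rewrite -natrM mulnb.
by apply: eq_bigr => p _; rewrite inE; case: ifP.
Qed.

Lemma is_pathP r a b m p : size p = r ->
  is_path a b m p <->
  [/\ (a <= r)%N, (b <= r)%N, nth [::] (m :: p) r = nseq N false &
      forall u, (u < r)%N ->
        scan (a == u.+1) (nth [::] (m :: p) u) (nth [::] (m :: p) u.+1) (b != u.+1)].
Proof.
elim: p a b m r => [|m' p IH] a b m r /= <-.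
  split=> [/and3P [/eqP -> /eqP -> /eqP ->] //|[ha hb hz _]].
  by move: ha hb; rewrite !leqn0 => -> ->; apply/eqP.
have E x u : (x.-1 == u.+1) = (x == u.+2) by case: x.
have L x u : (x.-1 <= u)%N = (x <= u.+1)%N by case: x.
split.
  case/andP=> sc /(IH _ _ _ _ erefl) [ha hb hz hu].
  by split; rewrite -?L // => -[|u] // ltu; have := hu u ltu; rewrite !E.
case=> ha hb hz hu; rewrite (hu 0%N isT); apply/(IH _ _ _ _ erefl).
by split; rewrite ?L // => u ltu; have := hu u.+1 ltu; rewrite !E.
Qed.

Local Notation n := N.+2.
Variables (a b : nat) (m : seq bool) (p : seq (seq bool)).
Hypothesis sp2 : forall u, (u <= N.+1)%N -> size (nth [::] (m :: p) u) = N.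

(* Bit [(u, j)]: whether the entries of column [j] in rows [>= u] sum to 1. *)
Definition Dbit (u j : nat) : bool :=
  if u is u'.+1 then
    if j is j'.+1 then
      if j' == N then (u' < b)%N else nth false (nth [::] (m :: p) u') j'
    else (u' < a)%N
  else true.

Definition Dent (u j : nat) : int := (Dbit u j)%:Z - (Dbit u.+1 j)%:Z.

(** By telescoping, partial column sums are 0 or 1 for any choice of bits; only the total depends on
    the last row of bits. *)
Lemma psum_col j l : psum (Dent^~ j) l = 1 - (Dbit l j)%:Z.
Proof.
by elim: l => [|l IH]; rewrite ?psum0 ?subrr // psumS IH /Dent; ring.
Qed.

Lemma psum_row u l : (l <= N)%N -> psum (Dent u.+1) l.+1 =
  (a == u.+1)%:Z +
  psum (fun j => (nth false (nth [::] (m :: p) u) j)%:Z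
                 - (nth false (nth [::] (m :: p) u.+1) j)%:Z) l.
Proof.
elim: l => [|l IH] lel.
  rewrite psumS !psum0 add0r addr0 /Dent /=; case: ltngtP; lia.
rewrite psumS IH ?(ltnW lel) // [in RHS]psumS.
rewrite /Dent [Dbit u.+1 _]/= [Dbit u.+2 _]/= (ltn_eqF lel).
exact: (esym (addrA _ _ _)).
Qed.

(** The entries in the outer columns are [a == u.+1] and [b == u.+1]: the first is the initial state
    of the scan, the second the complement of its final state. *)
Lemma prefix01_row u : (u <= N)%N ->
  prefix01 n (Dent u.+1) <->
  scan (a == u.+1) (nth [::] (m :: p) u) (nth [::] (m :: p) u.+1) (b != u.+1).
Proof.
move=> leu; rewrite scanP ?sp2 ?(leqW leu) //.
pose q l : int := (a == u.+1)%:Z +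
  psum (fun j => (nth false (nth [::] (m :: p) u) j)%:Z
                 - (nth false (nth [::] (m :: p) u.+1) j)%:Z) l.
have qE l : (l <= N)%N -> psum (Dent u.+1) l.+1 = q l by exact: psum_row.
have totE : psum (Dent u.+1) n = q N + (b == u.+1)%:Z.
  by rewrite psumS qE // /Dent /= eqxx; case: ltngtP; lia.
rewrite /prefix01 totE; split=> -[h1 h2].
  split=> [l lel|]; last by rewrite -/(q N); case: (b == _) h2 => /=; lia.
  by rewrite -/(q l) -qE //; apply: h1; lia.
rewrite -/(q N) in h2; split=> [[|l]|]; first by rewrite psum0; left.
  rewrite leq_eqVlt => /orP [/eqP [->]|ltl].
    by right; rewrite totE h2; case: (b == _).
  by rewrite qE //; apply: h1.
by rewrite h2; case: (b == _).
Qed.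

End Paths.

Section Borders.
Variables (N s t k : nat).
Local Notation n := N.+2.

Definition ASMset : {set 'M['I_3]_n} :=
  [set f | [&& is_ASM (mx_of_code f), one_at (mx_of_code f) s.+2 1,
            one_at (mx_of_code f) 1 k & one_at (mx_of_code f) t.+2 n]].

Lemma ASMsetP f : f \in ASMset -> exists2 w : nat -> nat -> int,
  (forall i j, mx_of_code f i j = w i j) &
  [/\ (forall i, (i < n)%N -> prefix01 n (w i)) /\
       (forall j, (j < n)%N -> prefix01 n (w^~ j)),
      [/\ (s.+1 < n)%N, (t.+1 < n)%N, (k.-1 < n)%N /\ (0 < k)%N &
       forall u, (u <= n)%N -> psum (w^~ 0%N) u = (s.+1 < u)%N%:Z],
      forall u, (u <= n)%N -> psum (w^~ N.+1) u = (t.+1 < u)%N%:Z &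
      forall l, (l <= n)%N -> psum (w 0%N) l = (k.-1 < l)%N%:Z].
Proof.
pose w i j := mx_of_code f (inord i : 'I_n) (inord j : 'I_n).
have AW (i j : 'I_n) : mx_of_code f i j = w i j by rewrite /w !inord_val.
rewrite inE => /and4P [/(is_ASM_prefix AW) [hr hc]].
case/existsP=> r1 /existsP [c1 /and3P [/eqP er1 /eqP ec1 /eqP]]; rewrite AW => e1.
case/existsP=> r2 /existsP [c2 /and3P [/eqP er2 /eqP ec2 /eqP]]; rewrite AW => e2.
case/existsP=> r3 /existsP [c3 /and3P [/eqP er3 /eqP ec3 /eqP]]; rewrite AW => e3.
move: er1 ec1 er2 ec2 er3 ec3 => [er1] [ec1] [er2] ec2 [er3] [ec3].
have lts : (s.+1 < n)%N by rewrite -er1.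
have ltt : (t.+1 < n)%N by rewrite -er3.
rewrite er1 ec1 in e1; rewrite er2 in e2; rewrite er3 ec3 in e3.
have ec2k := ec2; have {}ec2 : c2 = k.-1 :> nat by rewrite -ec2.
rewrite ec2 in e2; have ltk : (k.-1 < n)%N by rewrite -ec2.
(* An entry of the left column is a partial sum of its row, and one of the right column is 1 minus a
   partial sum; neither is negative, so each of these columns has a single 1. Likewise for the top
   row, by columns. *)
have C0 : forall u, (u <= n)%N -> psum (w^~ 0%N) u = (s.+1 < u)%N%:Z.
  apply: psum_unique => // [u ltu|]; last by case: (hc 0%N isT).
  by have [/(_ 1%N isT) + _] := hr u ltu; rewrite psumS psum0 add0r => -[] ->.
have CN : forall u, (u <= n)%N -> psum (w^~ N.+1) u = (t.+1 < u)%N%:Z.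
  apply: psum_unique => // [u ltu|]; last by case: (hc N.+1 (ltnSn _)).
  have [/(_ N.+1 (leqnSn _)) h] := hr u ltu; rewrite psumS.
  by case: h => ->; lia.
have R0 : forall l, (l <= n)%N -> psum (w 0%N) l = (k.-1 < l)%N%:Z.
  apply: psum_unique => // [j ltj|]; last by case: (hr 0%N isT).
  by have [/(_ 1%N isT) + _] := hc j ltj; rewrite psumS psum0 add0r => -[] ->.
by exists w => //; do !split=> //; rewrite -ec2k.
Qed.

End Borders.

(** * The bijection between paths of rows and alternating sign matrices *)

Section Bijection.
Variables (N s t k : nat).
Local Notation n := N.+2.
Hypothesis hk : (2 <= k <= N.+1)%N.
Local Notation m := (holebits N k).
Local Notation T := (N.+1.-tuple (N.-tuple bool)).
Local Notation D p := (@Dbit N s.+1 t.+1 m (map val (p : T))).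
Local Notation W p := (@Dent N s.+1 t.+1 m (map val (p : T))).

(** The code of an entry is the entry plus 1, and 1 minus a bit is its negation. *)
Definition path_code (p : T) : 'M['I_3]_n :=
  \matrix_(i, j) inord (D p i j + ~~ D p i.+1 j).

Lemma code_val (p : T) i j : path_code p i j = (D p i j + ~~ D p i.+1 j)%N :> nat.
Proof. by rewrite mxE inordK //; case: (D p _ _); case: (D p _ _). Qed.

Lemma mx_of_path_code p i j : mx_of_code (path_code p) i j = W p i j.
Proof. by rewrite mxE code_val /Dent; case: (D p _ _); case: (D p _ _). Qed.

Lemma size_rows (p : T) u : (u <= N.+1)%N ->
  size (nth [::] (m :: map val p) u) = N.
Proof.
case: u => [|u] leu /=; first by rewrite size_mkseq.
by rewrite (nth_map (nseq_tuple N false)) ?size_tuple.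
Qed.

Lemma DbitE (p : T) (u : 'I_N.+1) (j : 'I_N) :
  D p u.+2 j.+1 = tnth (tnth p u) j.
Proof.
rewrite /= ltn_eqF // (nth_map (tnth p u)) ?size_tuple //.
by rewrite -tnth_nth -tnth_nth.
Qed.

(** The bits of row 0 are all [true], and each matrix row then determines the next row of bits. *)
Lemma path_code_inj : injective path_code.
Proof.
move=> p p' epp.
have DE u j : (u <= n)%N -> (j < n)%N -> D p u j = D p' u j.
  move=> leu ltj; elim: u leu => [|u IH] leu //.
  have := congr1 (fun M : 'M_n => nat_of_ord (M (Ordinal leu) (Ordinal ltj))) epp.
  rewrite !code_val IH ?(ltnW leu) // => /addnI /eqP.
  by case: (D p _ _); case: (D p' _ _).
apply: eq_from_tnth => u; apply: eq_from_tnth => j.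
rewrite -!DbitE DE //; first exact: (ltn_ord u).
exact: (leqW (ltn_ord j)).
Qed.

Lemma Dent_top (p : T) j : (j < n)%N -> W p 0 j = (j == k.-1)%:Z.
Proof.
case: j => [|j] ltj; rewrite /Dent /=.
  by rewrite (_ : (0 == k.-1)%N = false) //; lia.
case: eqP => [->|ne]; first by rewrite (_ : (N.+1 == k.-1)%N = false) //; lia.
rewrite nth_mkseq; last by lia.
by rewrite (_ : (j.+1 == k.-1) = (j.+2 == k)); [case: (_ == _)|lia].
Qed.

Lemma path_code_ASM (p : T) :
  is_path N s.+1 t.+1 m (map val p) -> path_code p \in ASMset N s t k.
Proof.
have szp : size (map val p) = N.+1 by rewrite size_map size_tuple.
move/(is_pathP _ _ _ _ szp) => [les let_ z hu].
rewrite inE; apply/and4P; split.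
- apply/(is_ASM_prefix (@mx_of_path_code p)); split.
    case=> [|u] ltu; last first.
      by apply/(prefix01_row _ _ (@size_rows p)) => //; exact: hu.
    have pE l : (l <= n)%N -> psum (W p 0) l = (k.-1 < l)%N%:Z.
      apply: psum_unique => //.
      + by move=> j ltj; rewrite Dent_top.
      + rewrite /psum (eq_bigr (fun j : 'I_n => (j == inord k.-1)%:Z)).
          rewrite (bigD1 (inord k.-1)) //= eqxx big1 // => j /negPf ->; exact.
        move=> j _; rewrite Dent_top // -val_eqE /= inordK //; lia.
      + by lia.
      + by rewrite Dent_top ?eqxx //; lia.
    split=> [l lel|]; last by rewrite pE //; case: (ltnP k.-1 n) => //; lia.
    by rewrite pE //; case: (_ < _)%N; [right|left].
  move=> j ltj; have DN : Dbit N s.+1 t.+1 m (map val p) n j = false.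
    case: j ltj => [|j] ltj /=; first by lia.
    case: eqP => [_|ne]; first by lia.
    by move: z => /= ->; rewrite nth_nseq if_same.
  by split=> [l lel|]; rewrite psum_col ?DN //; case: (D p _ _); [left|right].
- apply/existsP; exists (Ordinal (les : (s.+1 < n)%N)); apply/existsP; exists ord0.
  by rewrite mx_of_path_code /Dent /= ?ltnS ?leqnn ?ltnn !eqxx.
- have hk' : (k.-1 < n)%N by lia.
  apply/existsP; exists ord0; apply/existsP; exists (Ordinal hk').
  rewrite mx_of_path_code Dent_top //= eqxx andbT; lia.
- apply/existsP; exists (Ordinal (let_ : (t.+1 < n)%N)); apply/existsP; exists ord_max.
  by rewrite mx_of_path_code /Dent /= !eqxx ltnSn ltnn.
Qed.

Lemma eq_prefix01 d w w' : (forall j, (j < d)%N -> w j = w' j) ->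
  prefix01 d w -> prefix01 d w'.
Proof.
move=> e; have E l : (l <= d)%N -> psum w l = psum w' l.
  by move=> lel; apply: eq_bigr => j _; apply: e; apply: leq_trans lel.
by case=> h1 h2; split=> [l lel|]; rewrite -E //; apply: h1.
Qed.

Lemma ASM_path_code f : f \in ASMset N s t k ->
  exists2 p : T, is_path N s.+1 t.+1 m (map val p) & f = path_code p.
Proof.
case/ASMsetP => w AW [[hr hc] [lts ltt _ C0] CN R0].
(* A column sums to 1 from row [u] on exactly when its sum before row [u] is 0. *)
pose B u j := psum (w^~ j) u == 0.
have BE u j : (u <= n)%N -> (j < n)%N -> (B u j)%:Z = 1 - psum (w^~ j) u.
  by move=> leu ltj; have [/(_ u leu) [h|h] _] := hc j ltj; rewrite /B h.
pose p : T := [tuple [tuple B u.+2 j.+1 | j < N] | u < N.+1].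
have DB u j : (u <= n)%N -> (j < n)%N -> D p u j = B u j.
  case: u => [|u] leu ltj; first by rewrite /B psum0 eqxx.
  case: j ltj => [|j] ltj; first by rewrite /= /B C0 //; case: ltngtP; lia.
  have [jN|jN] := eqVneq j N.
    by rewrite jN /= eqxx /B CN //; case: ltngtP; lia.
  have ltjN : (j < N)%N by lia.
  case: u leu => [|u] leu.
    rewrite /= (negPf jN) nth_mkseq // /B psumS psum0 add0r.
    have := R0 j.+2 ltj; rewrite psumS R0; last exact: ltnW.
    by case: (ltngtP k.-1 j.+1); case: (ltngtP k.-1 j.+2); lia.
  have := DbitE p (Ordinal (leu : (u < N.+1)%N)) (Ordinal ltjN).
  by rewrite /= !tnth_mktuple.
have WE u j : (u < n)%N -> (j < n)%N -> W p u j = w u j.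
  move=> ltu ltj; rewrite /Dent !DB ?(ltnW ltu) // !BE ?(ltnW ltu) // psumS; ring.
have szp : size (map val p) = N.+1 by rewrite size_map size_tuple.
exists p.
  apply/(is_pathP _ _ _ _ szp); split=> //.
    apply: (@eq_from_nth _ false) => [|j]; first by rewrite size_rows // size_nseq.
    rewrite size_rows // => ltj; rewrite nth_nseq ltj.
    have := DB n j.+1 (leqnn _) (leqW (ltj : (j.+1 < N.+1)%N)).
    rewrite {1}/Dbit ltn_eqF // => ->.
    by rewrite /B; have [_ ->] := hc j.+1 (leqW (ltj : (j.+1 < N.+1)%N)).
  move=> u ltu; apply/(prefix01_row _ _ (@size_rows p)) => //.
  by apply: (eq_prefix01 (w := w u.+1)) => [j ltj|]; [rewrite WE|exact: hr].
apply/matrixP => i j; apply: val_inj => /=; apply/eqP.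
have := AW i j; rewrite -WE // -mx_of_path_code !mxE => /addIr [] ->.
by [].
Qed.

Lemma card_ASMset : ASMcount n s.+2 k t.+2 =
  #|[set p : T | is_path N s.+1 t.+1 m (map val p)]|.
Proof.
rewrite -(card_imset _ path_code_inj); apply: eq_card => f.
apply/idP/imsetP.
  by move/ASM_path_code => [p hp ->]; exists p; rewrite ?inE.
by case=> p; rewrite inE => hp ->; exact: path_code_ASM.
Qed.

Lemma ASMcount_paths : (ASMcount n s.+2 k t.+2)%:R = paths N N.+1 s.+1 t.+1 m.
Proof. by rewrite card_ASMset paths_card. Qed.

End Bijection.

(** The 1s of the outer columns lie below the top row, so both top corners are 0. *)
Lemma ASMcount_eq0 N s t k : ~~ (2 <= k <= N.+1)%N ->
  ASMcount N.+2 s.+2 k t.+2 = 0%N.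
Proof.
move=> hk; apply/eqP; rewrite cards_eq0; apply/set0Pn => -[f].
case/ASMsetP => w _ [[hr hc] [lts ltt [ltk k0] C0] CN R0].
have tops : w 0%N 0%N = 0.
  by have := C0 1%N isT; rewrite psumS psum0 add0r.
have topN : w 0%N N.+1 = 0.
  by have := CN 1%N isT; rewrite psumS psum0 add0r.
have topk : w 0%N k.-1 = 1.
  have := R0 k.-1.+1 ltk; rewrite psumS R0 ?ltnn ?ltnSn; last exact: ltnW.
  by rewrite add0r.
have [k1|k1] := eqVneq k 1%N; first by move: topk; rewrite k1 tops.
have kN : k.-1 = N.+1 by lia.
by move: topk; rewrite kN topN.
Qed.

Lemma ASMcount_Hcoef m s k t :
  (ASMcount m.+3 s.+2 k t.+2)%:R = Hcoef m s k t.
Proof.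
have [hk|hk] := boolP (2 <= k <= m.+2)%N.
  by rewrite ASMcount_paths // paths_Hcoef.
rewrite ASMcount_eq0 //= /Hcoef.
rewrite (iter_ZopE _ (h := fun=> 0)); first by rewrite (iterop0 eq_Zop Zop_lin).
move=> z; rewrite (iter_XopE _ (h := fun=> 0)); first exact: (iterop0 eq_Xop Xop_lin).
by move=> x; rewrite /Hval (negPf hk).
Qed.

(** * The case n = 2 and the conclusion *)

Lemma alpha_kvec2 x y z : alpha (@kvec 2 x y z) = alphaL 2 [:: x; z].
Proof.
rewrite alpha_act /alphaL; congr shift_act; apply/rowP => i; rewrite !mxE /kvec.
by case: i => [[|[]]].
Qed.

(** The corner difference of alpha(2; x, z) is a [nodesum] over the empty list, hence 0. The counts
    vanish as well, as there is no inner column for the 1 of the top row. *)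
Lemma coef3_kvec2 b s i t :
  coef3 2 b (fun x y z => alpha (@kvec 2 x y z)) s.+1 i t.+1 = 0.
Proof.
rewrite /coef3 iterSr (iter_ZopE _ (h := fun=> 0)); first exact: (iterop0 eq_Zop Zop_lin).
move=> z; rewrite /Zop; apply/eqP; rewrite subr_eq0; apply/eqP.
apply: iter_ZopE => y; rewrite !iterSr; apply: iter_XopE => x.
have := @alphaL_corner 0 x z [::] erefl.
by rewrite /Xop !alpha_kvec2 /=; lra.
Qed.

Lemma polyfun_alpha_kvec n : (2 <= n)%N ->
  [/\ forall y z, polyfun n (fun x => alpha (@kvec n x y z)),
      forall x z, polyfun n (fun y => alpha (@kvec n x y z)) &
      forall x y, polyfun n (fun z => alpha (@kvec n x y z))].
Proof.
case: n => [|[|[|m]]] // _; split=> u v.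
- apply: (polyfun_ext (g := fun x => alphaL 2 ([::] ++ x :: [:: v]))); last exact: polyfun_alphaL.
  by move=> x; rewrite alpha_kvec2.
- by apply: (polyfun_ext (g := fun=> alphaL 2 [:: u; v])) (polyfun_const _ _) => y; rewrite alpha_kvec2.
- apply: (polyfun_ext (g := fun z => alphaL 2 ([:: u] ++ z :: [::]))); last exact: polyfun_alphaL.
  by move=> x; rewrite alpha_kvec2.
- apply: (polyfun_ext (g := fun x => alphaL m.+3 ([::] ++ x :: rcons (rcons (interval 2 m) u) v))).
    by move=> x; rewrite alpha_kvec.
  by apply: polyfun_alphaL; rewrite !size_rcons size_interval.
- apply: (polyfun_ext (g := fun y => alphaL m.+3 ((u :: interval 2 m) ++ y :: [:: v]))).
    by move=> y; rewrite alpha_kvec -!cats1 -catA.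
  by apply: polyfun_alphaL; rewrite /= size_interval addn1.
- apply: (polyfun_ext (g := fun z => alphaL m.+3 ((u :: rcons (interval 2 m) v) ++ z :: [::]))).
    by move=> y; rewrite alpha_kvec cats1.
  by apply: polyfun_alphaL; rewrite /= size_rcons size_interval addn0.
Qed.

Theorem theorem1 (n : nat) : (2 <= n)%N ->
  (exists c, is_expansion n c) /\
  forall c : nat -> nat -> nat -> rat, is_expansion n c ->
  forall s i t : nat,
    (2 <= s <= n)%N -> (1 <= i <= n)%N -> (2 <= t <= n)%N ->
    c s i t =
      (ASMcount n s.+1 i t)%:R + (ASMcount n s.+1 i t.+1)%:R
      + (ASMcount n s i.+1 t)%:R - (ASMcount n s.+1 i.+1 t)%:R
      - (ASMcount n s i t.+1)%:R - (ASMcount n s.+1 i.-1 t.+1)%:R.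
Proof.
move=> le2n; split.
  exists (fun s i t => coef3 2 (n%:Z - 2) (fun x y z => alpha (@kvec n x y z)) s.-1 i.-1 t.-1).
  have [px py pz] := polyfun_alpha_kvec le2n.
  by apply/expansionP => x y z; apply: (expansion3 2 (n%:Z - 2) (g := fun x y z => alpha (@kvec n x y z))).
move=> c /expansionP cE [|[|s]] [|i] [|[|t]] //= lts lti ltt.
pose c' s i t := c s.+1 i.+1 t.+1.
rewrite -[c _ _ _]/(c' s.+1 i t.+1).
rewrite -(coef3_unique (d := n) (a := 2) (b := n%:Z - 2)
  (g := fun x y z => alpha (@kvec n x y z)) cE lts lti ltt).
case: n le2n {c cE c'} lts lti ltt => [|[|[|m]]] // _ lts lti ltt.
  by rewrite coef3_kvec2 !ASMcount_eq0 ?addr0 ?subr0 //; lia.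
by rewrite coef3_Hcoef // !ASMcount_Hcoef.
Qed.
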